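(* Let $X$ be an infinite ultrahomogeneous discrete chain and $G=(\mathrm{Aut}(X),\tau_\partial)$. For $n\in\mathbb N$ let $J_X^n=\{f\in e_{\alpha X}G: |D(f)|\leq n\}$ where $D(f)=\{x\in X:f(x)\neq\infty\}$. Then, as compactifications of $G$, $e_{b_mX}G>e_{b^{\leftrightarrow}X}G>e_{b^+X}G>e_{\alpha X}G>e_{\alpha X}G/\rho_{J_X^1}>\dots>e_{\alpha X}G/\rho_{J_X^n}>e_{\alpha X}G/\rho_{J_X^{n+1}}>\dots$ and $e_{b_mX}G>e_{b^{\updownarrow}X}G>e_{b^+X}G$. If $X$ is continuously ordered, then $b_rG=e_{b_mX}G$; otherwise $e_{b_mX}G>b_rG>e_{\alpha X}G$ and $b_rG$ is incomparable with each of $e_{b^{\leftrightarrow}X}G$, $e_{b^{\updownarrow}X}G$, $e_{b^+X}G$.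
   Context: Ultrahomogeneous chain: for all $x_1<\dots<x_n$, $y_1<\dots<y_n$ there is an order automorphism with $g(x_k)=y_k$. $\tau_\partial$: topology of pointwise convergence for discrete $X$. $b_mX$: $X\times\{-1,0,1\}$ (lexicographic order) plus one point for each gap of $X$ (cut $(A,B)$, $A<B$, $A$ without max, $B$ without min, including $\inf$ and $\sup$), order topology, $X\equiv X\times\{0\}$. $b^{\leftrightarrow}X=b_mX/(\inf\sim\sup)$, $b^{\updownarrow}X=b_mX/((x,-1)\sim(x,1),x\in X)$, $b^+X=b_mX/((x,-1)\sim(x,1),x\in X,\inf\sim\sup)$, $\alpha X$ the one-point compactification; $G$ acts on all of them. For compact $K$, $e_KG$ is the closure of $\{x\mapsto gx\}$ in $K^K$ (product topology, composition). $S/\rho_I$ is the Rees quotient collapsing an ideal $I$ to a zero (quotient topology). $b_rG$ is the Roelcke compactification (completion w.r.t. uniformity with base covers $\{OgO\}$). Compactifications ordered by compatible continuous maps; $>$ means $\geq$ and not $\leq$. Continuously ordered: densely ordered without proper gaps. *)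

(* Defs.v *)
From HB Require Import structures.
From mathcomp Require Import all_boot all_order all_algebra.
From mathcomp Require Import all_classical all_reals all_analysis.
From mathcomp Require Import Rstruct Rstruct_topology generic_quotient.
Set Implicit Arguments. Unset Strict Implicit. Unset Printing Implicit Defensive.
Import Order.TTheory GRing.Theory Num.Theory.
Local Open Scope classical_set_scope.
Local Open Scope ring_scope.
Local Open Scope quotient_scope.

(* Compactifications of a (topological) group G, given as maps c : G -> K
   into a topological space; the compactification itself is the closure
   of the image, closure (range c).                                    *)
Record cpt (G : Type) := Cpt { cspace : topologicalType ; cmap : G -> cspace }.

Definition cpt_ge G (C1 C2 : cpt G) : Prop :=
  exists phi : cspace C1 -> cspace C2,
    {within closure (range (cmap C1)), continuous phi} /\
    (forall g, phi (cmap C1 g) = cmap C2 g).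
Definition cpt_gt G (C1 C2 : cpt G) : Prop := cpt_ge C1 C2 /\ ~ cpt_ge C2 C1.
Definition cpt_equiv G (C1 C2 : cpt G) : Prop := cpt_ge C1 C2 /\ cpt_ge C2 C1.
Definition cpt_incomparable G (C1 C2 : cpt G) : Prop :=
  ~ cpt_ge C1 C2 /\ ~ cpt_ge C2 C1.

Definition ecpt G (K : topologicalType) (act : G -> K -> K) : cpt G :=
  @Cpt G {ptws K -> K} act.

Section KerQuot.
Context (T : topologicalType) (K : Type) (k : T -> K).
Definition kerrel : rel T := fun a b => `[< k a = k b >].
Lemma kerrel_refl : reflexive kerrel.
Proof. by move=> a; apply/asboolP. Qed.
Lemma kerrel_sym : symmetric kerrel.
Proof. by move=> a b; apply/asboolP/asboolP => ->. Qed.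
Lemma kerrel_trans : transitive kerrel.
Proof. by move=> b a c /asboolP H1 /asboolP H2; apply/asboolP; rewrite H1. Qed.
Definition ker_equiv : equiv_rel T :=
  EquivRel kerrel kerrel_refl kerrel_sym kerrel_trans.
Definition kquot : topologicalType := quotient_topology {eq_quot ker_equiv}.
Definition kpi (t : T) : kquot := \pi_({eq_quot ker_equiv}) t.
(* action induced on the quotient (well defined for the actions used below) *)
Definition kact G (act : G -> T -> T) (g : G) (q : kquot) : kquot :=
  kpi (act g (repr (q : {eq_quot ker_equiv}))).
End KerQuot.

Section Chain.
Context {disp : Order.disp_t} (X : orderType disp).

Record aut := Aut {
  af : X -> X ; ainv : X -> X ;
  af_can : cancel af ainv ; ainv_can : cancel ainv af ;
  af_mono : {mono af : x y / (x <= y)%O } }.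

Definition ultrahomogeneous : Prop :=
  forall (n : nat) (s t : 'I_n -> X),
    (forall i j : 'I_n, (i < j)%N -> (s i < s j)%O) ->
    (forall i j : 'I_n, (i < j)%N -> (t i < t j)%O) ->
    exists g : aut, forall k, af g (s k) = t k.

(* gaps: cuts (A, ~`A) with A < ~`A, A without max, ~`A without min
   (A = set0 is the gap inf, A = setT the gap sup)                   *)
Definition is_cut (A : set X) : Prop :=
  [/\ (forall x y, (y <= x)%O -> A x -> A y),
      (forall a, A a -> exists b, A b /\ (a < b)%O) &
      (forall b, ~ A b -> exists a, ~ A a /\ (a < b)%O)].
Record gap := Gap { gset : set X ; gapP : is_cut gset }.

Definition continuously_ordered : Prop :=
  (forall a b : X, (a < b)%O -> exists c, (a < c)%O /\ (c < b)%O) /\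
  (forall A : gap, gset A = set0 \/ gset A = setT).

Lemma ainv_mono (g : aut) : {mono ainv g : x y / (x <= y)%O}.
Proof. by move=> x y; rewrite -(af_mono g) !ainv_can. Qed.

Lemma gap_act_cut (g : aut) (A : gap) : is_cut [set y | gset A (ainv g y)].
Proof.
case: A => A [Hd Hm Hn] /=; split.
- by move=> x y yx; apply: Hd; rewrite ainv_mono.
- move=> a /Hm [b [Ab ab]]; exists (af g b); rewrite /= af_can; split => //.
  by rewrite -(leW_mono (ainv_mono g)) af_can.
- move=> b /Hn [a [Aa ab]]; exists (af g a); rewrite /= af_can; split => //.
  by rewrite -(leW_mono (ainv_mono g)) af_can.
Qed.

Definition gap_act (g : aut) (A : gap) : gap := Gap (gap_act_cut g A).

(* b_m X = X x {-1,0,1} (lexicographic) plus one point for each gap *)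
Inductive tri := Mi | Ze | Pl.
Definition tri_lt (i j : tri) : Prop :=
  match i, j with Mi, Ze | Mi, Pl | Ze, Pl => True | _, _ => False end.

Inductive bm := BPt of X & tri | BGap of gap.

Definition bm_lt (a b : bm) : Prop :=
  match a, b with
  | BPt x i, BPt y j => (x < y)%O \/ (x = y /\ tri_lt i j)
  | BPt x _, BGap B => gset B x
  | BGap A, BPt y _ => ~ gset A y
  | BGap A, BGap B => gset A `<=` gset B /\ ~ (gset B `<=` gset A)
  end.

HB.instance Definition _ := gen_eqMixin bm.
HB.instance Definition _ := gen_choiceMixin bm.

Definition bm_ray (r : option (bool * bm)) : set bm :=
  match r with
  | None => setT
  | Some (true, a) => [set y | bm_lt y a]
  | Some (false, a) => [set y | bm_lt a y]
  end.

HB.instance Definition _ :=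
  @isSubBaseTopological.Build bm (option (bool * bm)) setT bm_ray.

Definition bm_act (g : aut) (a : bm) : bm :=
  match a with
  | BPt x i => BPt (af g x) i
  | BGap A => BGap (gap_act g A)
  end.

Definition bm_end (a : bm) : Prop :=
  match a with BGap A => gset A = set0 \/ gset A = setT | _ => False end.
Definition bm_flip (a : bm) : bm :=
  match a with BPt x Pl => BPt x Mi | _ => a end.

Definition k_lr (a : bm) : option bm := if `[< bm_end a >] then None else Some a.
Definition k_ud (a : bm) : bm := bm_flip a.
Definition k_plus (a : bm) : option bm :=
  if `[< bm_end a >] then None else Some (bm_flip a).

Definition bLR := kquot k_lr.
Definition bUD := kquot k_ud.
Definition bPlus := kquot k_plus.

Definition aX : topologicalType :=
  one_point_compactification (discrete_topology X).
Definition a_act (g : aut) (p : aX) : aX := omap (af g) p.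

Definition e_bm : cpt aut := ecpt bm_act.
Definition e_lr : cpt aut := ecpt (kact bm_act (k := k_lr)).
Definition e_ud : cpt aut := ecpt (kact bm_act (k := k_ud)).
Definition e_plus : cpt aut := ecpt (kact bm_act (k := k_plus)).
Definition e_alpha : cpt aut := ecpt a_act.

Definition Dom (f : {ptws aX -> aX}) : set X := [set x | f (Some x) <> None].
Definition J (n : nat) (f : {ptws aX -> aX}) : Prop :=
  closure (range (cmap e_alpha)) f /\
  exists s : seq X, Dom f `<=` [set` s] /\ (size s <= n)%N.

Definition k_rees (n : nat) (f : {ptws aX -> aX}) : option {ptws aX -> aX} :=
  if `[< J n f >] then None else Some f.
Definition rees (n : nat) : cpt aut :=
  @Cpt aut (kquot (k_rees n)) (fun g => kpi (k_rees n) (cmap e_alpha g)).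

(* Roelcke uniformity: O_F = pointwise stabiliser of a finite set F
   (a base of identity neighbourhoods of tau_partial); entourages
   {(x,y) | y in O_F x O_F}. *)
Definition stab (F : seq X) (h : aut) : Prop := forall x, x \in F -> af h x = x.
Definition roelcke_close (F : seq X) (x y : aut) : Prop :=
  exists a b, stab F a /\ stab F b /\ forall z, af y z = af a (af x (af b z)).
Definition roelcke_uc (f : aut -> Rdefinitions.R) : Prop :=
  forall e : Rdefinitions.R, 0 < e -> exists F : seq X,
    forall x y, roelcke_close F x y -> `|f x - f y| < e.
Definition bounded_fun (f : aut -> Rdefinitions.R) : Prop := exists M : Rdefinitions.R, forall g, `|f g| <= M.
Definition RUC := {f : aut -> Rdefinitions.R | roelcke_uc f /\ bounded_fun f}.

Definition b_r : cpt aut :=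
  @Cpt aut {ptws RUC -> Rdefinitions.R} (fun g u => proj1_sig u g).

End Chain.

(* Main.v *)
Require Import Defs.
From HB Require Import structures.
From mathcomp Require Import all_boot all_order all_algebra.
From mathcomp Require Import all_classical all_reals all_analysis.
From mathcomp Require Import Rstruct Rstruct_topology generic_quotient finmap lra.
Import Order.TTheory GRing.Theory Num.Theory.
Import numFieldNormedType.Exports.
Local Open Scope classical_set_scope.
Set Implicit Arguments.
Unset Strict Implicit.

(* A point of [b_m X] is determined by its position (below, at, above) with
   respect to each [y : X], and the topology is the initial one for these
   locally constant positions; conversely every coherent choice of positions is
   realized, which replaces compactness. Since [X] is ultrahomogeneous, the
   double cosets of the stabiliser of a finite [s] are the order types of
   [(s, g s)], so [b_r G] is the closure [e_X] of [G] in [(b_m X)^X]; it recovers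
   [e_{b_m X} G] exactly when no proper gap has to be moved.
   The comparisons are induced by equivariant quotient maps. To refute
   [C1 >= C2] one exhibits two filters on [G] with the same limit in [C1] that
   are eventually outside the two members of an open cover of [C2]. The filters
   squeeze all of [X] towards [inf], [sup] or [(x, -1)], [(x, 1)]; or fix a finite
   set and send the rest to [infinity]; or squeeze the two sides of a proper
   gap while moving the gap itself in two ways. *)

(** * Pointwise convergence and relative continuity *)

Lemma ptws_cvgP (I : Type) (T : topologicalType) (F : set_system {ptws I -> T})
    (f : {ptws I -> T}) : Filter F ->
  F --> f <-> forall i, (fun h : {ptws I -> T} => h i) @ F --> f i.
Proof.
move=> FF; rewrite cvg_sup; split=> H i; have := H i.
  rewrite cvg_image; last by rewrite eqEsubset; split=> v // _; exists (fun=> v).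
  move=> H1 W /H1 [W' FW' <-]; rewrite /nbhs /=.
  by apply: filterS FW' => g W'g; exists g.
rewrite cvg_image; last by rewrite eqEsubset; split=> v // _; exists (fun=> v).
move=> + W; move=> /[apply] FW; exists ((fun h : {ptws I -> T} => h i) @^-1` W) => //.
by rewrite eqEsubset; split => [j [? + <-//]|j Wj]; exists (fun _ => j).
Qed.

Lemma ptws_eval_continuous (I : Type) (T : topologicalType) (i : I) :
  continuous (fun h : {ptws I -> T} => h i).
Proof. by move=> f; exact: (@ptws_cvgP I T (nbhs f) f _).1. Qed.

Lemma ptws_continuous (S : topologicalType) (I : Type) (T : topologicalType)
    (f : S -> {ptws I -> T}) :
  (forall i, continuous (fun t => f t i)) -> continuous f.
Proof. by move=> H t; apply/ptws_cvgP => i; exact: H. Qed.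

Lemma within_continuousP (T U : topologicalType) (A : set T) (f : T -> U) :
  {within A, continuous f} <->
  forall x, A x -> f @ within A (nbhs x) --> f x.
Proof. exact: subspace_continuousP. Qed.

(** * Comparison maps between compactifications and how to refute them *)

Section Comparison.
Context (G : Type).
Implicit Types C D : cpt G.

Definition cclosure C : set (cspace C) := closure (range (cmap C)).
Arguments cclosure : clear implicits.

Lemma cpt_ge_trans C1 C2 C3 : cpt_ge C1 C2 -> cpt_ge C2 C3 -> cpt_ge C1 C3.
Proof.
move=> [f [/within_continuousP cf fE]] [h [/within_continuousP ch hE]].
exists (h \o f); split; last by move=> g; rewrite /= fE hE.
apply/within_continuousP => x cx.
(* Both maps are continuous only relative to closures, so composing them requires [f] to carry the
   first closure into the second. *)
have clf (y : cspace C1) : cclosure C1 y -> cclosure C2 (f y).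
  move=> cy W /(cf y cy); rewrite /nbhs /= /within /= => nW.
  have [_ [[g _ <-] Wg]] := cy _ nW.
  exists (cmap C2 g); split; first by exists g.
  by rewrite -fE; apply: Wg; apply: subset_closure; exists g.
move=> W /(ch _ (clf _ cx)); rewrite /nbhs /= /within /= => nW.
have := cf _ cx _ nW; rewrite /nbhs /= /within /=; apply: filterS => y H cy.
by apply: (H cy); exact: clf.
Qed.

Lemma cpt_ge_continuous C1 C2 (f : cspace C1 -> cspace C2) :
  continuous f -> (forall g, f (cmap C1 g) = cmap C2 g) -> cpt_ge C1 C2.
Proof.
by move=> cf fE; exists f; split=> //; exact: continuous_subspaceT.
Qed.

(** A comparison map [f] would be continuous at [p], which lies in the closure because each of its
    neighbourhoods meets the image of [G]. The value [f p] lies in [U1] or in [U2], and that member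
    would then contain the images of all [g] close to [p]. *)
Lemma not_cpt_ge C1 C2 (p : cspace C1) (U1 U2 : set (cspace C2)) :
  open U1 -> open U2 -> (forall z, U1 z \/ U2 z) ->
  (forall W, nbhs p W -> exists2 g, W (cmap C1 g) & ~ U1 (cmap C2 g)) ->
  (forall W, nbhs p W -> exists2 g, W (cmap C1 g) & ~ U2 (cmap C2 g)) ->
  ~ cpt_ge C1 C2.
Proof.
move=> oU1 oU2 U12 H1 H2 [f [/within_continuousP cf fE]].
have cp : cclosure C1 p.
  by move=> W /H1 [g Wg _]; exists (cmap C1 g); split => //; exists g.
have nU (U : set (cspace C2)) : open U -> U (f p) ->
    ~ (forall W, nbhs p W -> exists2 g, W (cmap C1 g) & ~ U (cmap C2 g)).
  move=> oU Up H.
  have /(cf _ cp) : nbhs (f p) U by exact: open_nbhs_nbhs.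
  rewrite /nbhs /= /within /= => /H [g Wg]; rewrite -fE; apply.
  by apply: Wg; apply: subset_closure; exists g.
by case: (U12 (f p)) => /nU; apply.
Qed.

Lemma not_cpt_ge_cvg C1 C2 (F1 F2 : set_system G) (p : cspace C1)
    (U1 U2 : set (cspace C2)) : ProperFilter F1 -> ProperFilter F2 ->
  cmap C1 @ F1 --> p -> cmap C1 @ F2 --> p ->
  open U1 -> open U2 -> (forall z, U1 z \/ U2 z) ->
  F1 [set g | ~ U1 (cmap C2 g)] -> F2 [set g | ~ U2 (cmap C2 g)] ->
  ~ cpt_ge C1 C2.
Proof.
move=> PF1 PF2 c1 c2 o1 o2 U12 n1 n2; apply: (@not_cpt_ge _ _ p U1 U2) => // W pW.
  by have [g [Wg ng]] := filter_ex (filterI (c1 _ pW : F1 [set g | W (cmap C1 g)]) n1); exists g.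
by have [g [Wg ng]] := filter_ex (filterI (c2 _ pW : F2 [set g | W (cmap C1 g)]) n2); exists g.
Qed.

Lemma not_cpt_ge_ptws C1 (I : Type) (T : topologicalType)
    (c : G -> {ptws I -> T}) (F1 F2 : set_system G) (p : cspace C1) (i : I)
    (U1 U2 : set T) : ProperFilter F1 -> ProperFilter F2 ->
  cmap C1 @ F1 --> p -> cmap C1 @ F2 --> p ->
  open U1 -> open U2 -> (forall z, U1 z \/ U2 z) ->
  F1 [set g | ~ U1 (c g i)] -> F2 [set g | ~ U2 (c g i)] ->
  ~ cpt_ge C1 (Cpt c).
Proof.
move=> PF1 PF2 c1 c2 o1 o2 U12 n1 n2.
pose e (h : {ptws I -> T}) := h i.
have oe U : open U -> open (e @^-1` U).
  by move=> oU; apply: open_comp => // h _; exact: ptws_eval_continuous.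
exact: (@not_cpt_ge_cvg C1 (Cpt c) F1 F2 p (e @^-1` U1) (e @^-1` U2) _ _
  c1 c2 (oe _ o1) (oe _ o2) (fun z => U12 (z i)) n1 n2).
Qed.

(** Continuity into a power is coordinatewise, so the coordinates of a comparison map can be built
    separately, each as a limit along traces of neighbourhoods. *)
Lemma cpt_ge_ptws C1 (I : Type) (T : topologicalType) (c : G -> {ptws I -> T}) :
  (forall i, exists phi : cspace C1 -> T,
    {within cclosure C1, continuous phi} /\ forall g, phi (cmap C1 g) = c g i) ->
  cpt_ge C1 (Cpt c).
Proof.
move=> /choice [phi H]; exists (fun p i => phi i p); split; last first.
  by move=> g; apply/funext => i; rewrite (H i).2.
apply/within_continuousP => x cx; apply/ptws_cvgP => i.
by apply: (within_continuousP _ _).1 cx; exact: (H i).1.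
Qed.

(* Points of the closure are limits along the traces of their neighbourhoods,
   so a family of local conditions that is coherent on [range (cmap C)]
   transfers from one point of the closure to the nearby ones. *)
Lemma clo_meet C p (W W' : set (cspace C)) :
  cclosure C p -> nbhs p W -> nbhs p W' -> exists g, W (cmap C g) /\ W' (cmap C g).
Proof.
by move=> cp nW nW'; have [_ [[g _ <-] WW]] := cp _ (filterI nW nW'); exists g.
Qed.

End Comparison.
Arguments cclosure {G} C : rename.

(** * Quotients by the kernel of a map, and the induced actions *)

Section Quotient.
Local Open Scope quotient_scope.
Context (T : topologicalType) (K : Type) (k : T -> K).

Lemma kpi_eq a b : k a = k b -> kpi k a = kpi k b.
Proof. by move=> ab; apply/eqquotP; apply/asboolP. Qed.

Lemma kpiP a b : kpi k a = kpi k b -> k a = k b.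
Proof. by move=> /eqquotP /asboolP. Qed.

Definition krepr (q : kquot k) : T := repr (q : {eq_quot ker_equiv k}).

Lemma kpi_krepr q : kpi k (krepr q) = q.
Proof. exact: reprK. Qed.

Lemma krepr_kpi a : k (krepr (kpi k a)) = k a.
Proof. by apply: kpiP; rewrite kpi_krepr. Qed.

Lemma kpi_continuous : continuous (kpi k : T -> kquot k).
Proof. exact: pi_continuous. Qed.

(** Saturation of [V] makes the choice of representative harmless: the preimage under the projection
    is [V] itself. *)
Lemma kquot_open (V : set T) : open V -> (forall a b, k a = k b -> V a -> V b) ->
  open [set q : kquot k | V (krepr q)].
Proof.
move=> oV sV; rewrite /open /= /quotient_open.
suff -> : \pi_(quotient_topology {eq_quot ker_equiv k}) @^-1` [set q | V (krepr q)] = V by [].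
rewrite eqEsubset; split=> a /=; apply: sV; first exact: krepr_kpi.
exact/esym/krepr_kpi.
Qed.

Lemma kquot_continuous (Z : topologicalType) (f : kquot k -> Z) :
  continuous (f \o kpi k) -> continuous f.
Proof. by move=> H; apply/quotient_continuous. Qed.

Lemma kact_kpi (G : Type) (act : G -> T -> T) :
  (forall g a b, k a = k b -> k (act g a) = k (act g b)) ->
  forall g a, kact (k := k) act g (kpi k a) = kpi k (act g a).
Proof. by move=> H g a; apply: kpi_eq; apply: H; exact: krepr_kpi. Qed.

End Quotient.

(** * Positions with respect to points of the chain, and the topology of [bm X] *)

Section Position.
Local Open Scope order_scope.
Local Open Scope classical_set_scope.
Context {disp : Order.disp_t} {X : orderType disp}.
Implicit Types (x y w : X) (a b z : bm X) (A B : gap X) (i j : tri).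

(* The position of [a] with respect to the point [(y, 0)]. *)
Definition cmp y a : tri :=
  match a with
  | BPt x i => if y < x then Pl else if x < y then Mi else i
  | BGap A => if `[< gset A y >] then Pl else Mi
  end.

Lemma cmp_lt y x i : x < y -> cmp y (BPt x i) = Mi.
Proof. by move=> xy /=; rewrite xy ltNge (ltW xy). Qed.

Lemma cmp_gt y x i : y < x -> cmp y (BPt x i) = Pl.
Proof. by move=> xy /=; rewrite xy. Qed.

Lemma cmp_eq x i : cmp x (BPt x i) = i.
Proof. by rewrite /= ltxx. Qed.

Lemma cmpMiP y a : cmp y a = Mi <-> bm_lt a (BPt y Ze).
Proof.
case: a => [x i|A] /=; last by case: asboolP => H; split.
case: (ltgtP y x) => [yx|xy|<-]; split => //.
- by case=> // -[E]; rewrite E ltxx in yx.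
- by left.
- by move=> ->; right.
- by case=> [//|[_]]; case: i.
Qed.

Lemma cmpPlP y a : cmp y a = Pl <-> bm_lt (BPt y Ze) a.
Proof.
case: a => [x i|A] /=; last by case: asboolP => H; split.
case: (ltgtP y x) => [yx|xy|<-]; split => //.
- by left.
- by case=> // -[E]; rewrite E ltxx in xy.
- by move=> ->; right.
- by case=> [//|[_]]; case: i.
Qed.

Lemma cmpZeP y a : cmp y a = Ze <-> a = BPt y Ze.
Proof.
split=> [|->]; last exact: cmp_eq.
by case: a => [x i|A] /=; [case: ltgtP => // -> ->|case: ifP].
Qed.

Lemma gap_down A x y : gset A x -> y <= x -> gset A y.
Proof. by move=> Ax yx; case: (gapP A) => H _ _; exact: H Ax. Qed.

Lemma gap_lt A x y : gset A x -> ~ gset A y -> x < y.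
Proof.
by move=> Ax Ay; rewrite ltNge; apply/negP => yx; apply: Ay; exact: gap_down yx.
Qed.

Lemma gap_up A x : gset A x -> exists2 y, gset A y & x < y.
Proof. by case: (gapP A) => _ H _ /H [y [? ?]]; exists y. Qed.

Lemma gap_dn A x : ~ gset A x -> exists2 y, ~ gset A y & y < x.
Proof. by case: (gapP A) => _ _ H /H [y [? ?]]; exists y. Qed.

Lemma cmp_gap y A : cmp y (BGap A) = if `[< gset A y >] then Pl else Mi.
Proof. by []. Qed.

(** This is the only constraint relating the positions of one point at different places;
    [cmp_realize] is the converse. *)
Lemma cmp_mono y w a : y < w -> cmp w a <> Mi -> cmp y a = Pl.
Proof.
case: a => [x i|A] yw /=.
  by case: (ltgtP w x) => [wx|//|<-] _; rewrite ?(lt_trans yw wx) ?yw.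
case: asboolP => // Aw _; case: asboolP => //.
by have := gap_down Aw (ltW yw).
Qed.

Lemma bm_lt_trans_cmp b y x j : cmp y b = Mi -> y < x -> bm_lt b (BPt x j).
Proof.
move=> /cmpMiP; case: b => [x' i|A] /= H yx.
  by left; case: H => [x'y|[-> _] //]; exact: lt_trans yx.
by move=> Ax; apply: H; exact: gap_down Ax (ltW yx).
Qed.

Lemma bm_lt_trans_cmp' b y x j : cmp y b = Pl -> x < y -> bm_lt (BPt x j) b.
Proof.
move=> /cmpPlP; case: b => [x' i|A] /= H yx; last exact: gap_down H (ltW yx).
by left; case: H => [yx'|[<- _] //]; exact: lt_trans yx'.
Qed.

Lemma bm_lt_gap_cmp b y B : cmp y b = Mi -> gset B y -> bm_lt b (BGap B).
Proof.
move=> /cmpMiP; case: b => [x i|A] /= H By.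
  by apply: gap_down By _; case: H => [/ltW|[->]].
split; last by move=> /(_ _ By).
by move=> w Aw; apply: (gap_down By); exact/ltW/(gap_lt Aw).
Qed.

Lemma bm_lt_gap_cmp' b y B : cmp y b = Pl -> ~ gset B y -> bm_lt (BGap B) b.
Proof.
move=> /cmpPlP; case: b => [x i|A] /= H By.
  by move=> Bx; apply: By; apply: gap_down Bx _; case: H => [/ltW|[->]].
split; last by move=> /(_ _ H).
by move=> w Bw; apply: (gap_down H); exact/ltW/(gap_lt Bw).
Qed.

Definition chain_dense := forall x y, x < y -> exists2 w, x < w & w < y.
Definition chain_nomin := forall x, exists y, y < x.
Definition chain_nomax := forall x, exists y, x < y.

Context (Xdense : chain_dense).

Lemma bm_lt_below a z :
  bm_lt z a -> exists y, forall b, cmp y b = cmp y z -> bm_lt b a.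
Proof.
case: a z => [x j|B] [x' i|A] /=.
- case=> [x'x|[-> ij]].
    have [y x'y yx] := Xdense x'x; exists y => b /=.
    by rewrite x'y ltNge (ltW x'y) /= => /bm_lt_trans_cmp; apply.
  exists x => b; rewrite ltxx; case: b => [w k|C] /=.
    case: (ltgtP x w) => [xw|wx|<-]; last by move=> ->; right.
      by move=> E; move: ij; rewrite -E.
    by left.
  by case: asboolP => // Cx E; move: ij; rewrite -E.
- move=> /gap_dn [y Ay yx]; exists y => b /=.
  by case: asboolP => // _ /bm_lt_trans_cmp; apply.
- move=> /gap_up [y By x'y]; exists y => b /=.
  by rewrite x'y ltNge (ltW x'y) /= => /bm_lt_gap_cmp; apply.
- move=> [_ /existsNP [y /not_implyP [By Ay]]]; exists y => b /=.
  by case: asboolP => // _ /bm_lt_gap_cmp; apply.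
Qed.

Lemma bm_lt_above a z :
  bm_lt a z -> exists y, forall b, cmp y b = cmp y z -> bm_lt a b.
Proof.
case: a z => [x j|B] [x' i|A] /=.
- case=> [xx'|[<- ij]].
    have [y xy yx'] := Xdense xx'; exists y => b /=.
    by rewrite yx' => /bm_lt_trans_cmp'; apply.
  exists x => b; rewrite ltxx; case: b => [w k|C] /=.
    case: (ltgtP x w) => [xw|wx|<-]; last by move=> ->; right.
      by left.
    by move=> E; move: ij; rewrite -E; case: (j).
  by case: asboolP => // Cx E; move: ij; rewrite -E; case: (j).
- move=> /gap_up [y Ay xy]; exists y => b /=.
  by case: asboolP => // _ /bm_lt_trans_cmp'; apply.
- move=> /gap_dn [y By yx']; exists y => b /=.
  by rewrite yx' => /bm_lt_gap_cmp'; apply.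
- move=> [_ /existsNP [y /not_implyP [Ay By]]]; exists y => b /=.
  by case: asboolP => // _ /bm_lt_gap_cmp'; apply.
Qed.

Lemma bm_ray_open r : open (bm_ray r : set (bm X)).
Proof.
exists [set bm_ray r]; last by rewrite bigcup_set1.
move=> _ ->; exists [fset r]%fset; first by move=> i _; rewrite in_setT.
rewrite eqEsubset; split=> a /=; first by apply; rewrite /= in_fset1.
by move=> H r'; rewrite /= in_fset1 => /eqP ->.
Qed.

Lemma bm_lt_open a : open [set b | bm_lt b a].
Proof. exact: (bm_ray_open (Some (true, a))). Qed.

Lemma bm_gt_open a : open [set b | bm_lt a b].
Proof. exact: (bm_ray_open (Some (false, a))). Qed.

Lemma cmp_open y i : open [set a | cmp y a = i].
Proof.
case: i.
- rewrite (_ : [set _ | _] = [set a | bm_lt a (BPt y Ze)]); first exact: bm_lt_open.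
  by rewrite eqEsubset; split=> a /= /cmpMiP.
(* The point (y, 0) is isolated, being alone strictly between (y, -1) and (y, 1). *)
- rewrite (_ : [set _ | _] = [set a | bm_lt (BPt y Mi) a] `&` [set a | bm_lt a (BPt y Pl)]).
    by apply: openI; [exact: bm_gt_open|exact: bm_lt_open].
  rewrite eqEsubset; split=> a /=.
    by move=> /cmpZeP -> /=; split; right.
  case: a => [x i|A] /= [] // [yx|[<- ti]] [xy|[E ti']].
  + by have := lt_trans yx xy; rewrite ltxx.
  + by move: yx; rewrite E ltxx.
  + by move: xy; rewrite ltxx.
  + by rewrite ltxx; case: i ti ti'.
- rewrite (_ : [set _ | _] = [set a | bm_lt (BPt y Ze) a]); first exact: bm_gt_open.
  by rewrite eqEsubset; split=> a /= /cmpPlP.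
Qed.

(** Together with [cmp_open] this says that the topology is initial for the positions: a basic
    neighbourhood is a finite intersection of rays, and one test point suffices for each ray. *)
Lemma bm_nbhs_cmp z (W : set (bm X)) : nbhs z W ->
  exists s : seq X, forall a, (forall y, y \in s -> cmp y a = cmp y z) -> W a.
Proof.
rewrite nbhsE => -[B [[D' sD' <-] [V DV Vz0]] BW].
have Vz : V z := Vz0.
have [L _ VL] := sD' _ DV.
have H r : exists s : seq X, r \in L ->
    forall b, (forall y, y \in s -> cmp y b = cmp y z) -> bm_ray r b.
  have [rL|/negP rL] := boolP (r \in L); last by exists [::].
  have : bm_ray r z by move: Vz; rewrite -VL => /(_ r); apply.
  case: r rL => [[[] a]|] rL /=.
  - by move=> /bm_lt_below [y yz]; exists [:: y] => _ b /(_ y (mem_head _ _)) /yz.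
  - by move=> /bm_lt_above [y yz]; exists [:: y] => _ b /(_ y (mem_head _ _)) /yz.
  - by exists [::].
have [f fP] := choice H.
exists (flatten [seq f r | r <- (L : seq _)]) => a aP; apply: BW.
exists V => //; suff : V a by []; rewrite -VL => r /= rL; apply: (fP r rL) => y yr; apply: aP.
by apply/flatten_mapP; exists r.
Qed.

Lemma cmp_near (F : set_system (bm X)) z (s : seq X) : Filter F ->
  (forall y, F [set a | cmp y a = cmp y z]) ->
  F [set a | forall y, y \in s -> cmp y a = cmp y z].
Proof.
move=> FF H; elim: s => [|y s IH]; first by apply: filterS filterT.
apply: filterS2 (H y) IH => a ya sa w; rewrite inE => /orP [/eqP ->//|]; exact: sa.
Qed.

Lemma bm_cvgP (F : set_system (bm X)) z : Filter F ->
  F --> z <-> forall y, F [set a | cmp y a = cmp y z].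
Proof.
move=> FF; split=> [Fz y|H W /bm_nbhs_cmp [s sW]].
  by apply: Fz; apply: open_nbhs_nbhs; split => //; exact: cmp_open.
by apply: filterS sW _; exact: cmp_near.
Qed.

(** Density is essential here: if x' were the successor of x, then (x, 1) and (x', -1) would have
    the same positions. *)
Lemma cmp_inj a b : (forall y, cmp y a = cmp y b) -> a = b.
Proof.
have pt x i j : (forall y, cmp y (BPt x i) = cmp y (BPt x j)) -> i = j.
  by move=> /(_ x); rewrite !cmp_eq.
have lt x x' i j : x < x' -> ~ forall y, cmp y (BPt x i) = cmp y (BPt x' j).
  move=> /Xdense [y xy yx'] /(_ y); by rewrite (cmp_lt _ xy) (cmp_gt _ yx').
have gp x i A : ~ forall y, cmp y (BPt x i) = cmp y (BGap A).
  have [Ax|Ax] := pselect (gset A x).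
    have [y Ay xy] := gap_up Ax => /(_ y).
    by rewrite (cmp_lt _ xy) /=; case: asboolP.
  have [y Ay xy] := gap_dn Ax => /(_ y).
  by rewrite (cmp_gt _ xy) /=; case: asboolP.
case: a b => [x i|A] [x' j|B] H.
- case: (ltgtP x x') H => [/lt + /[dup] H|/lt + H|->]; first by move=> /(_ _ _ H).
    by move=> /(_ j i); case=> y; rewrite H.
  by move=> /pt ->.
- by case: (gp _ _ _ H).
- by case: (gp x' j A) => y; rewrite H.
- congr BGap; have E : gset A = gset B.
    by rewrite eqEsubset; split=> y; have := H y => /=;
      case: asboolP => //; case: asboolP.
  by case: A B E {H} => A pA [B pB] /= E; subst; congr Gap; exact: Prop_irrelevance.
Qed.

(* This is the compactness of [bm X]. *)
Lemma cmp_realize (t : X -> tri) :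
  (forall y w, y < w -> t w <> Mi -> t y = Pl) ->
  exists z, forall y, cmp y z = t y.
Proof.
move=> tP.
have tMi y w : y < w -> t y <> Pl -> t w = Mi.
  by move=> yw ty; case E : (t w) => //; case: ty; apply: tP yw _; rewrite E.
have [[x tx]|nZe] := pselect (exists x, t x = Ze).
  exists (BPt x Ze) => y /=; case: (ltgtP y x) => [yx|xy|->//].
    by rewrite (tP _ _ yx) // tx.
  by rewrite (tMi _ _ xy) // tx.
have PM y : t y <> Pl -> t y = Mi.
  by case E : (t y) => // _; case: nZe; exists y.
(* With no position [Ze], the [Pl] part is an initial segment. A last element x gives (x, 1), a
   first element x of the complement gives (x, -1), and otherwise the segment is a gap. *)
have [[x [tx xmax]]|nmax] := pselect (exists x, t x = Pl /\ forall y, x < y -> t y = Mi).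
  exists (BPt x Pl) => y /=; case: (ltgtP y x) => [yx|xy|->//].
    by rewrite (tP _ _ yx) // tx.
  by rewrite xmax.
have [[x [tx xmin]]|nmin] := pselect (exists x, t x = Mi /\ forall y, y < x -> t y = Pl).
  exists (BPt x Mi) => y /=; case: (ltgtP y x) => [yx|xy|->//].
    by rewrite xmin.
  by rewrite (tMi _ _ xy) // tx.
have cut : is_cut [set y | t y = Pl].
  split=> [x y|a ta|b tb] /=.
  - by rewrite le_eqVlt => /orP [/eqP ->//|yx] tx; apply: tP yx _; rewrite tx.
  - apply: contrapT => /forallNP H; apply: nmax; exists a; split => // y ay.
    by apply: PM => ty; apply: (H y).
  - apply: contrapT => /forallNP H; apply: nmin; exists b; split; first exact: PM.
    by move=> y yb; apply: contrapT => ty; apply: (H y).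
exists (BGap (Gap cut)) => y /=; case: asboolP => //= ty; exact/esym/PM.
Qed.

End Position.

(** * Consequences of ultrahomogeneity and approximation by automorphisms *)

Section Homogeneity.
Local Open Scope order_scope.
Local Open Scope classical_set_scope.
Context {disp : Order.disp_t} {X : orderType disp}.
Implicit Types (x y w : X) (a b z : bm X) (A B : gap X) (i j : tri) (g : aut X).

Lemma af_lt g x y : (af g x < af g y) = (x < y).
Proof. exact: (leW_mono (af_mono g)). Qed.

Lemma seq_has_max (s : seq X) :
  s = [::] \/ exists2 m, m \in s & forall x, x \in s -> x <= m.
Proof.
elim: s => [|a s [->|[m ms mP]]]; first by left.
  by right; exists a => [|x]; rewrite inE // => /eqP ->.
right; exists (Order.max a m).
  by rewrite inE /Order.max; case: ifP; rewrite ?ms ?orbT ?eqxx.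
by move=> x; rewrite inE le_max => /orP [/eqP ->|/mP ->]; rewrite ?lexx ?orbT.
Qed.

Lemma seq_has_min (s : seq X) :
  s = [::] \/ exists2 m, m \in s & forall x, x \in s -> m <= x.
Proof.
elim: s => [|a s [->|[m ms mP]]]; first by left.
  by right; exists a => [|x]; rewrite inE // => /eqP ->.
right; exists (Order.min a m).
  by rewrite inE /Order.min; case: ifP; rewrite ?ms ?orbT ?eqxx.
by move=> x; rewrite inE ge_min => /orP [/eqP ->|/mP ->]; rewrite ?lexx ?orbT.
Qed.

Section Ultrahomogeneous.
Context (Xhom : ultrahomogeneous X).

(** Sorting [s] without repetitions produces the two increasing tuples that [ultrahomogeneous]
    expects. *)
Lemma aut_extend (s : seq X) (h : X -> X) :
  (forall x y, x \in s -> y \in s -> x < y -> h x < h y) ->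
  exists g, forall x, x \in s -> af g x = h x.
Proof.
move=> hP; pose s' := sort <=%O (undup s).
have s's x : (x \in s') = (x \in s) by rewrite mem_sort mem_undup.
have srt : sorted <%O s' by rewrite sort_lt_sorted undup_uniq.
pose u (i : 'I_(size s')) := tnth (in_tuple s') i.
have us (k : 'I_(size s')) : u k \in s by rewrite -s's mem_tnth.
have umono (i j : 'I_(size s')) : (i < j)%N -> u i < u j.
  move=> ij; rewrite /u (tnth_nth (u i)) (tnth_nth (u i) _ j).
  by apply: (sorted_ltn_nth lt_trans) => //; rewrite inE /= ltn_ord.
have [g gP] := Xhom umono (fun (i j : 'I_(size s')) ij => hP _ _ (us i) (us j) (umono i j ij)).
exists g => x; rewrite -s's => xs.
have ix : (index x s' < size s')%N by rewrite index_mem.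
have <- : u (Ordinal ix) = x by rewrite /u (tnth_nth x) /= nth_index.
exact: gP.
Qed.

Context (Xinf : ~ finite_set [set: X]).

Lemma chain_fresh (s : seq X) : exists x, x \notin s.
Proof.
apply: contrapT => /forallNP H; apply: Xinf.
apply: (@sub_finite_set _ _ [set` s]); last exact: finite_seq.
by move=> x _ /=; have := H x; case: (x \in s).
Qed.

Lemma chain_lt_ex : exists x y, x < y.
Proof.
have [x _] := chain_fresh [::]; have [y] := chain_fresh [:: x].
by rewrite inE; case: ltgtP => // xy _; [exists y, x|exists x, y].
Qed.

Lemma aut_pt x y : exists g, af g x = y.
Proof.
have [|g /(_ x (mem_head _ _))] := @aut_extend [:: x] (fun=> y); last by exists g.
by move=> ? ?; rewrite !inE => /eqP -> /eqP ->; rewrite ltxx.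
Qed.

Lemma chain_nominP : chain_nomin (X := X).
Proof.
move=> x; have [u [v uv]] := chain_lt_ex.
by have [g <-] := aut_pt v x; exists (af g u); rewrite af_lt.
Qed.

Lemma chain_nomaxP : chain_nomax (X := X).
Proof.
move=> x; have [u [v uv]] := chain_lt_ex.
by have [g <-] := aut_pt u x; exists (af g v); rewrite af_lt.
Qed.

(** Some triple u < v < w exists; an automorphism taking u, w to x, y puts the image of v between
    them. *)
Lemma chain_denseP : chain_dense (X := X).
Proof.
move=> x y xy; have [u [v uv]] := chain_lt_ex; have [w vw] := chain_nomaxP v.
have [|g gP] := @aut_extend [:: u; w] (fun t => if t == u then x else y).
  move=> ? ?; rewrite !inE => /orP [] /eqP -> /orP [] /eqP ->; rewrite ?ltxx ?eqxx //.
    by rewrite (gt_eqF (lt_trans uv vw)).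
  by move=> wu; have := lt_trans (lt_trans uv vw) wu; rewrite ltxx.
have gu := gP u (mem_head _ _); have gw := gP w (mem_last u [:: w]).
rewrite eqxx in gu; rewrite (gt_eqF (lt_trans uv vw)) in gw.
by exists (af g v); rewrite -1?gu -1?gw af_lt.
Qed.

Lemma chain_between (L U : seq X) :
  (forall l u, l \in L -> u \in U -> l < u) ->
  exists v, (forall l, l \in L -> l < v) /\ (forall u, u \in U -> v < u).
Proof.
move=> LU; have [x0 _] := chain_fresh [::].
have [->|[m mL mP]] := seq_has_max L; have [->|[n nU nP]] := seq_has_min U.
- by exists x0.
- have [v vn] := chain_nominP n; exists v; split => // u /nP.
  exact: lt_le_trans.
- have [v mv] := chain_nomaxP m; exists v; split => // u /mP lm.
  exact: le_lt_trans mv.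
- have [v mv vn] := chain_denseP (LU _ _ mL nU); exists v; split => u.
    by move=> /mP lm; exact: le_lt_trans mv.
  by move=> /nP; exact: lt_le_trans.
Qed.

(* [f] is increasing, strictly so at points of [X]: these are the limits of
   automorphisms. *)
Definition bm_incr (f : X -> bm X) :=
  forall x x' y, x < x' -> cmp y (f x) <> Mi -> cmp y (f x') = Pl.

Lemma bm_incrMi f x x' y : bm_incr f -> x < x' -> cmp y (f x') <> Pl ->
  cmp y (f x) = Mi.
Proof.
by move=> fP xx' ny; apply: contrapT => H; apply: ny; exact: fP H.
Qed.

(** These are the traces on [G] of basic neighbourhoods of [f] in the power of [bm X]. One list
    serves both as arguments and as test points, so that concatenation directs the family. *)
Definition approximates (f : X -> bm X) (s : seq X) : set (aut X) :=
  [set g | forall x y, x \in s -> y \in s ->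
    cmp y (BPt (af g x) Ze) = cmp y (f x)].

(** A finite partial map with the prescribed positions is built one argument at a time and then
    extended by homogeneity. *)
Lemma approx_ex f s : bm_incr f -> exists g, approximates f s g.
Proof.
move=> fP.
suff [h [hlt hP]] : exists h : X -> X,
    (forall x y, x \in s -> y \in s -> x < y -> h x < h y) /\
    (forall x y, x \in s -> y \in s -> cmp y (BPt (h x) Ze) = cmp y (f x)).
  have [g gP] := aut_extend hlt; exists g => x y xs ys.
  by rewrite gP //; exact: hP.
(* The induction runs over the arguments only; the test points stay fixed. *)
suff H (l : seq X) : exists h : X -> X,
    (forall x y, x \in l -> y \in l -> x < y -> h x < h y) /\
    (forall x y, x \in l -> y \in s -> cmp y (BPt (h x) Ze) = cmp y (f x)).
  exact: H.
elim: l => [|x l [h [hlt hP]]]; first by exists id.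
have [xl|xl] := boolP (x \in l).
  exists h; split=> [u v|u v]; rewrite !inE.
    by move=> /orP [/eqP ->|ul] /orP [/eqP ->|vl]; exact: hlt.
  by move=> /orP [/eqP ->|ul]; exact: hP.
suff [v [vP [vl vu]]] : exists v, (forall y, y \in s -> cmp y (BPt v Ze) = cmp y (f x)) /\
    (forall w, w \in l -> w < x -> h w < v) /\ (forall w, w \in l -> x < w -> v < h w).
  have ne w : w \in l -> (w == x) = false.
    by move=> wl; apply/eqP => wx; rewrite -wx wl in xl.
  exists (fun w => if w == x then v else h w); split=> [y w|y w]; rewrite !inE.
    move=> /orP [/eqP ->|yl] /orP [/eqP ->|wl]; rewrite ?ltxx ?eqxx ?ne //.
    - exact: vu.
    - exact: vl.
    - exact: hlt.
  by move=> /orP [/eqP ->|yl]; rewrite ?eqxx ?ne //; [exact: vP|exact: hP].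
have hlo w u : w \in l -> w < x -> u \in s -> cmp u (f x) <> Pl -> h w < u.
  move=> wl wx us ux; have := hP w u wl us.
  by rewrite (bm_incrMi fP wx ux) => /cmpMiP /= [|[]].
have hup w u : w \in l -> x < w -> u \in s -> cmp u (f x) <> Mi -> u < h w.
  move=> wl wx us ux; have := hP w u wl us.
  by rewrite (fP _ _ _ wx ux) => /cmpPlP /= [|[]].
(* If [f x] is a test point, the new value is forced; strictness of [f] at points of [X] keeps it
   apart from the other values. *)
have [[y0 ys y0P]|nZe] := pselect (exists2 y0, y0 \in s & cmp y0 (f x) = Ze).
  move: (y0P) => /cmpZeP E; exists y0; rewrite E; split => //.
  by split=> w wl wx; [apply: hlo wl wx ys _|apply: hup wl wx ys _]; rewrite y0P.
(* The lower bounds are the test points below [f x] and the values at smaller arguments; [U] is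
   dual. Every lower bound is below every upper one, so a value fits between. *)
pose L := [seq y <- s | `[< cmp y (f x) = Pl >]] ++ [seq h w | w <- l & w < x].
pose U := [seq y <- s | `[< cmp y (f x) = Mi >]] ++ [seq h w | w <- l & x < w].
have [p u|v [vL vU]] := @chain_between L U.
  rewrite !mem_cat => /orP [|/mapP [w]]; rewrite mem_filter.
    move=> /andP [/asboolP px ps] /orP [|/mapP [w]]; rewrite mem_filter.
      move=> /andP [/asboolP ux us]; rewrite ltNge; apply/negP.
      rewrite le_eqVlt => /orP [/eqP up|up]; first by move: ux; rewrite up px.
      by have : cmp u (f x) = Pl; [apply: cmp_mono up _; rewrite px|rewrite ux].
    by move=> /andP [xw wl] ->; apply: hup => //; rewrite px.
  move=> /andP [wx wl] -> /orP [|/mapP [w']]; rewrite mem_filter.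
    by move=> /andP [/asboolP ux us]; apply: hlo => //; rewrite ux.
  by move=> /andP [xw' w'l] ->; apply: hlt => //; exact: lt_trans xw'.
exists v; split => [y ys|].
  case E : (cmp y (f x)).
  - by apply/cmp_lt/vU; rewrite mem_cat mem_filter ys asboolT.
  - by case: nZe; exists y.
  - by apply/cmp_gt/vL; rewrite mem_cat mem_filter ys asboolT.
split=> w wl wx; [apply: vL|apply: vU]; rewrite mem_cat; apply/orP; right;
  by apply/mapP; exists w => //; rewrite mem_filter wx.
Qed.

Definition approx_filter (f : X -> bm X) : set_system (aut X) :=
  filter_from [set: seq X] (approximates f).

Lemma approxS f s s' g : {subset s <= s'} -> approximates f s' g -> approximates f s g.
Proof. by move=> ss H x y /ss xs /ss ys; exact: H. Qed.

#[global] Instance approx_filter_filter f : Filter (approx_filter f).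
Proof.
apply: filter_from_filter; first by exists [::].
move=> s s' _ _; exists (s ++ s') => // g gP.
by split; apply: approxS gP => x xs; rewrite mem_cat xs ?orbT.
Qed.

Lemma approx_filter_proper f : bm_incr f -> ProperFilter (approx_filter f).
Proof.
by move=> fP; apply: filter_from_proper => s _; have [g] := approx_ex s fP; exists g.
Qed.

Lemma approx_filterP f x y :
  approx_filter f [set g | cmp y (BPt (af g x) Ze) = cmp y (f x)].
Proof.
by exists [:: x; y] => // g gP; apply: gP; rewrite !inE eqxx ?orbT.
Qed.

Lemma approx_near f s : approx_filter f (approximates f s).
Proof. exact: (@in_filter_from _ _ [set: seq X] (approximates f) s). Qed.

Lemma approx_pt_cvg f x :
  (fun g => BPt (af g x) Ze : bm X) @ approx_filter f --> f x.
Proof. apply/(bm_cvgP chain_denseP) => y; exact: approx_filterP. Qed.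

Definition bm_const z : X -> bm X := fun=> z.

(** Strictness is demanded only at points of [X], so constants outside [X] are limits of
    automorphisms; these are the squeezing limits. *)
Lemma bm_const_incr z : (forall y, cmp y z <> Ze) -> bm_incr (bm_const z).
Proof. by move=> zP x x' y _; rewrite /bm_const; have := zP y; case: cmp. Qed.

Lemma bm_end_fixed g a y : bm_end a -> cmp y (bm_act g a) = cmp y a.
Proof.
case: a => // A /= [] ->; rewrite /mkset.
  by case: asboolP => //; case: asboolP.
by case: asboolP => // H; case: H.
Qed.

(** Squeezing [X] towards [z] drags along every point of [bm X] except the two fixed ends. *)
Lemma act_const_cvg z : (forall y, cmp y z <> Ze) ->
  forall a, (fun g => bm_act g a) @ approx_filter (bm_const z) -->
    (if `[< bm_end a >] then a else z).
Proof.
move=> zP a; apply/(bm_cvgP chain_denseP) => y; case: asboolP => [aE|nE].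
  apply: (@filterS _ (approx_filter (bm_const z)) _ setT); last exact: filterT.
  by move=> g _; exact: bm_end_fixed.
case: a nE => [x i|A] nE.
  (* Since [z] is never at [y], eventually g x differs from [y], and then the three points over g x
     have the same position at [y]. *)
  apply: filterS (approx_filterP (bm_const z) x y) => g.
  by have := zP y; rewrite /bm_const /=; case: ltgtP => // _ H E; move: H; rewrite -E.
have [nA0 nAT] := (not_orP _ _).1 (nE : ~ (gset A = set0 \/ gset A = setT)).
(* A proper gap is trapped between points [x1] and [x2] of [X], both of which are squeezed to
   [z]. *)
have [x1 Ax1] : exists x, gset A x.
  by apply: contrapT => /forallNP H; apply: nA0; rewrite eqEsubset; split=> x // /H.
have [x2 Ax2] : exists x, ~ gset A x.
  apply: contrapT => /forallNP H; apply: nAT; rewrite eqEsubset; split=> x // _.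
  exact: contrapT (H x).
apply: filterS2 (approx_filterP (bm_const z) x1 y) (approx_filterP (bm_const z) x2 y).
move=> g; rewrite /bm_const => g1 g2; change (cmp y (bm_act g (BGap A)) = cmp y z).
rewrite /bm_act cmp_gap /=.
case E : (cmp y z) (zP y) => // _.
- rewrite asboolF // => H; move: g2; rewrite E => /cmpMiP /= [|[]] // yl.
  have := gap_lt H Ax2; rewrite -(af_lt g) ainv_can => /(lt_trans yl).
  by rewrite ltxx.
- rewrite asboolT //; apply: gap_down Ax1 _.
  move: g1; rewrite E => /cmpPlP /= [|[]] // yl.
  by apply: ltW; rewrite -(af_lt g) ainv_can.
Qed.

End Ultrahomogeneous.
End Homogeneity.

(** * Comparison maps induced by equivariant quotients *)

Section Comparisons.
Local Open Scope order_scope.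
Local Open Scope classical_set_scope.
Context {disp : Order.disp_t} {X : orderType disp}.
Implicit Types (x y w : X) (a b z : bm X) (i j : tri) (g : aut X).

(** Compactness in near-covering form is applied to the filter of lists ordered by inclusion: each
    point, being open, is eventually listed. *)
Lemma discrete_compact_seq (A : set (discrete_topology X)) : compact A ->
  exists s : seq X, forall x, A x -> x \in s.
Proof.
move=> /compact_near_coveringP H.
pose F : set_system (seq X) :=
  filter_from [set: seq X] (fun s => [set s' : seq X | {subset s <= s'}]).
have FF : Filter F.
  apply: filter_from_filter; first by exists [::].
  move=> s s' _ _; exists (s ++ s') => // t tP.
  by split => x xs; apply: tP; rewrite mem_cat xs ?orbT.
have [|s _ sP] := H _ F (fun s (x : X) => x \in s) FF.
  move=> x Ax; exists ([set x], [set s | x \in s]).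
    split; first exact: discrete_set1.
    by exists [:: x] => // s /(_ x (mem_head _ _)).
  by move=> [x' s] /= [->].
by exists s => x Ax; exact: (sP s).
Qed.

(* [e_{b_m X}] only restricted to [X]; it turns out to be the Roelcke
   compactification. *)
Definition e_X : cpt (aut X) :=
  Cpt (fun g => (fun x => BPt (af g x) Ze) : {ptws X -> bm X}).

Lemma e_bm_ge_e_X : cpt_ge (e_bm X) e_X.
Proof.
apply: (@cpt_ge_continuous _ (e_bm X) e_X
  (fun (f : {ptws bm X -> bm X}) => fun x => f (BPt x Ze))) => //.
by apply: ptws_continuous => x; exact: ptws_eval_continuous.
Qed.

(** Conjugating [f] by the projection and the chosen section gives, on [G], exactly the definition
    of [kact]. *)
Lemma e_bm_ge_kquot (K : Type) (k : bm X -> K) :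
  cpt_ge (e_bm X) (ecpt (kact (@bm_act _ X) (k := k))).
Proof.
apply: (@cpt_ge_continuous _ (e_bm X) (ecpt (kact (@bm_act _ X) (k := k)))
  (fun (f : {ptws bm X -> bm X}) => fun q : kquot k => kpi k (f (krepr q)))) => //.
apply: ptws_continuous => q f; apply: (@continuous_comp _ _ _ (fun f : {ptws bm X -> bm X} => f (krepr q))).
  exact: ptws_eval_continuous.
exact: kpi_continuous.
Qed.

Definition equivariant (K : Type) (k : bm X -> K) :=
  forall g a b, k a = k b -> k (bm_act g a) = k (bm_act g b).

(** The factor map [m] between the quotients is composed with [f] evaluated at a lift of the class;
    equivariance identifies the result on [G]. *)
Lemma kquot_ge_kquot (K K' : Type) (k : bm X -> K) (k' : bm X -> K') :
  (forall a b, k a = k b -> k' a = k' b) -> equivariant k -> equivariant k' ->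
  cpt_ge (ecpt (kact (@bm_act _ X) (k := k))) (ecpt (kact (@bm_act _ X) (k := k'))).
Proof.
move=> kk' ek ek'.
pose m (q : kquot k) : kquot k' := kpi k' (krepr q).
have mE a : m (kpi k a) = kpi k' a by apply/kpi_eq/kk'/krepr_kpi.
have cm : continuous m.
  apply: kquot_continuous; rewrite (_ : m \o _ = kpi k'); first exact: kpi_continuous.
  exact/funext.
apply: (@cpt_ge_continuous _ (ecpt (kact (@bm_act _ X) (k := k)))
    (ecpt (kact (@bm_act _ X) (k := k')))
  (fun (f : {ptws kquot k -> kquot k}) => fun q : kquot k' => m (f (kpi k (krepr q))))).
  apply: ptws_continuous => q f.
  apply: (@continuous_comp _ _ _ (fun f : {ptws kquot k -> kquot k} => f (kpi k (krepr q))) m).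
    exact: ptws_eval_continuous.
  exact: cm.
by move=> g; apply/funext => q; rewrite /ecpt /= kact_kpi // mE.
Qed.

Lemma bm_end_act g a : bm_end (bm_act g a) <-> bm_end a.
Proof.
case: a => //= A; split; case=> H; [left|right|left|right].
- rewrite eqEsubset; split=> // x Ax; have : [set y | gset A (ainv g y)] (af g x).
    by rewrite /= af_can.
  by rewrite H.
- rewrite eqEsubset; split=> // x _; have : [set: X] (af g x) by [].
  by rewrite -H /= af_can.
- by rewrite H.
- by rewrite H.
Qed.

Lemma bm_flip_act g a : bm_flip (bm_act g a) = bm_act g (bm_flip a).
Proof. by case: a => // x []. Qed.

Lemma k_lr_equiv : equivariant (@k_lr _ X).
Proof.
move=> g a b; rewrite /k_lr.
rewrite (asbool_equiv_eq (bm_end_act g a)) (asbool_equiv_eq (bm_end_act g b)).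
by case: asboolP; case: asboolP => // _ _ [->].
Qed.

Lemma k_ud_equiv : equivariant (@k_ud _ X).
Proof. by move=> g a b; rewrite /k_ud !bm_flip_act => ->. Qed.

Lemma k_plus_equiv : equivariant (@k_plus _ X).
Proof.
move=> g a b; rewrite /k_plus !bm_flip_act.
rewrite (asbool_equiv_eq (bm_end_act g a)) (asbool_equiv_eq (bm_end_act g b)).
by case: asboolP; case: asboolP => // _ _ [->].
Qed.

Lemma bm_flip_end a : bm_end (bm_flip a) <-> bm_end a.
Proof. by case: a => // x []. Qed.

Lemma e_lr_ge_e_plus : cpt_ge (e_lr X) (e_plus X).
Proof.
apply: kquot_ge_kquot; [|exact: k_lr_equiv|exact: k_plus_equiv].
by move=> a b; rewrite /k_lr /k_plus; do 2! case: asboolP => //; move=> _ _ [->].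
Qed.

Lemma e_ud_ge_e_plus : cpt_ge (e_ud X) (e_plus X).
Proof.
apply: kquot_ge_kquot; [|exact: k_ud_equiv|exact: k_plus_equiv].
move=> a b; rewrite /k_ud /k_plus => ab.
rewrite -(asbool_equiv_eq (bm_flip_end a)) -(asbool_equiv_eq (bm_flip_end b)).
by rewrite ab.
Qed.

Definition bm_alpha a : aX X := if a is BPt x Ze then Some x else None.

Lemma bm_alpha_pt a x : bm_alpha a = Some x -> a = BPt x Ze.
Proof. by case: a => // w [] //= [->]. Qed.

Lemma k_plus_alpha a b : k_plus a = k_plus b -> bm_alpha a = bm_alpha b.
Proof.
rewrite /k_plus; case: asboolP; case: asboolP => //; last first.
  by case: a b => [x []|A] [w []|B] //= _ _ [->].
by case: a b => [x i|A] [w j|B].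
Qed.

Lemma e_alpha_ge_rees n : cpt_ge (e_alpha X) (rees X n).
Proof.
apply: (@cpt_ge_continuous _ (e_alpha X) (rees X n) (kpi (@k_rees _ X n))) => //.
exact: kpi_continuous.
Qed.

Lemma k_rees_leq n n' f f' : (n <= n')%N ->
  k_rees (X := X) n f = k_rees n f' -> k_rees n' f = k_rees n' f'.
Proof.
move=> nn'; have JJ h : J (X := X) n h -> J n' h.
  by move=> [H [s [Hs ss]]]; split => //; exists s; split => //; exact: leq_trans nn'.
rewrite {1 2}/k_rees; case: asboolP => Jf; case: asboolP => // Jf'; last by case=> ->.
by rewrite /k_rees !asboolT //; exact: JJ.
Qed.

Lemma rees_ge_rees n n' : (n <= n')%N -> cpt_ge (rees X n) (rees X n').
Proof.
move=> nn'.
pose m (q : kquot (@k_rees _ X n)) : kquot (@k_rees _ X n') := kpi _ (krepr q).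
have mE h : m (kpi (@k_rees _ X n) h) = kpi (@k_rees _ X n') h.
  by apply/kpi_eq/(k_rees_leq nn')/krepr_kpi.
apply: (@cpt_ge_continuous _ (rees X n) (rees X n') m); last by move=> g; exact: mE.
apply: kquot_continuous; rewrite (_ : m \o _ = kpi (@k_rees _ X n')); first exact: kpi_continuous.
exact/funext.
Qed.

Section Ultrahomogeneous.
Context (Xhom : ultrahomogeneous X) (Xinf : ~ finite_set [set: X]).
Let Xdense := chain_denseP Xhom Xinf.

Lemma bm_alpha_continuous : continuous bm_alpha.
Proof.
move=> z.
have cyl (s : seq X) : nbhs z [set a | forall y, y \in s -> cmp y a = cmp y z].
  by apply: (@cmp_near _ _ (nbhs z)) => y; apply: open_nbhs_nbhs; split => //; exact: cmp_open.
case E : (bm_alpha z) => [x|] W.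
  have Ez := bm_alpha_pt E; move=> /nbhs_singleton Wx.
  apply: (@filterS _ (nbhs z) _ _ _ _ (cyl [:: x])) => a /(_ x (mem_head _ _)).
  by rewrite Ez cmp_eq => /cmpZeP ->; move: Wx; rewrite Ez.
(* A neighbourhood of infinity misses only a finite set of points of [X]. As [z] is none of these, a
   point with the same positions as [z] there is none of them either. *)
rewrite E => -[C [cC _] CW]; have [s sP] := discrete_compact_seq cC.
apply: (@filterS _ (nbhs z) _ _ _ _ (cyl s)) => a aP; apply: CW.
case Ea : (bm_alpha a) => [x|]; [left|by right].
exists x => // /sP /aP; have -> := bm_alpha_pt Ea; rewrite cmp_eq => /esym /cmpZeP Ez.
by rewrite Ez in E.
Qed.

Lemma e_X_ge_e_alpha : cpt_ge e_X (e_alpha X).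
Proof.
apply: (@cpt_ge_continuous _ e_X (e_alpha X)
  (fun (f : {ptws X -> bm X}) => fun p => if p is Some x then bm_alpha (f x) else None)).
  apply: ptws_continuous => -[x|] f; last exact: cst_continuous.
  apply: (@continuous_comp _ _ _ (fun f : {ptws X -> bm X} => f x)).
    exact: ptws_eval_continuous.
  exact: bm_alpha_continuous.
by move=> g; apply/funext => -[x|].
Qed.

Lemma e_plus_ge_e_alpha : cpt_ge (e_plus X) (e_alpha X).
Proof.
pose r (q : bPlus X) := bm_alpha (krepr q).
have rE a : r (kpi _ a) = bm_alpha a by apply/k_plus_alpha/krepr_kpi.
have cr : continuous r.
  apply: kquot_continuous; rewrite (_ : r \o _ = bm_alpha).
    exact: bm_alpha_continuous.
  exact/funext.
apply: (@cpt_ge_continuous _ (e_plus X) (e_alpha X)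
  (fun (f : {ptws bPlus X -> bPlus X}) =>
    fun p => if p is Some x then r (f (kpi _ (BPt x Ze))) else None)).
  apply: ptws_continuous => -[x|] f; last exact: cst_continuous.
  apply: (@continuous_comp _ _ _ (fun f : {ptws bPlus X -> bPlus X} => f (kpi _ (BPt x Ze))) r).
    exact: ptws_eval_continuous.
  exact: cr.
by move=> g; apply/funext => -[x|] //; rewrite /e_plus /= kact_kpi ?rE //; exact: k_plus_equiv.
Qed.

(** The limit at (x, j) is determined by the limit at (x, 0): if the latter is some (y, 0), its
    middle entry is replaced by j, and otherwise the two limits coincide. The only gaps are the
    ends, which are fixed. *)
Lemma e_X_ge_e_bm : continuously_ordered X -> cpt_ge e_X (e_bm X).
Proof.
move=> [_ noGap].
pose c a j : bm X := if a is BPt x Ze then BPt x j else a.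
have cE y a j : cmp y (c a j) = if cmp y a is Ze then j else cmp y a.
  by case: a => [x []|A] /=; [case: (ltgtP y x)..|case: asboolP].
have cc j : continuous (c^~ j).
  move=> z; apply: (bm_cvgP Xdense _ (fmap_filter _ (nbhs_filter z))).2 => y.
  have : nbhs z [set a | cmp y a = cmp y z].
    by apply: open_nbhs_nbhs; split => //; exact: cmp_open.
  by apply: filterS => a; rewrite /= !cE => ->.
apply: (@cpt_ge_continuous _ e_X (e_bm X) (fun (f : {ptws X -> bm X}) =>
    fun a => match a with BPt x j => c (f x) j | BGap A => BGap A end)).
  apply: ptws_continuous => -[x j|A] f; last exact: cst_continuous.
  apply: (@continuous_comp _ _ _ (fun f : {ptws X -> bm X} => f x) (c^~ j)).
    exact: ptws_eval_continuous.
  exact: cc.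
move=> g; apply/funext => -[x j //|A]; apply: (cmp_inj Xdense) => y.
by apply/esym; apply: bm_end_fixed; exact: noGap.
Qed.

End Ultrahomogeneous.
End Comparisons.

(** * The Roelcke compactification as the closure of the group in a power of [bm X] *)

Lemma real_cauchy_lim (R : realType) (F : set_system R) : ProperFilter F ->
  (forall e : R, (0 < e)%R -> exists x, F [set y | `|x - y| < e]%R) ->
  exists v, forall e : R, (0 < e)%R -> F [set y | `|v - y| < e]%R.
Proof.
move=> PF H; have cF : cauchy (F : set_system R^o) by apply/cauchy_exP.
exists (lim (F : set_system R^o)) => e e0.
by have /cvgrPdist_lt /(_ e e0) : (F : set_system R^o) --> lim (F : set_system R^o)
  by exact: cauchy_cvg.
Qed.

Lemma R_cvg_dist (T : Type) (F : set_system T) (f : T -> Rdefinitions.R)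
    (v : Rdefinitions.R) : Filter F ->
  f @ F --> v <-> forall e : Rdefinitions.R, (0 < e)%R -> F [set t | `|v - f t| < e]%R.
Proof.
by move=> FF; exact: (@cvgrPdist_lt (Rdefinitions.R : realType) (Rdefinitions.R : realType)^o).
Qed.

Section Roelcke.
Local Open Scope order_scope.
Local Open Scope classical_set_scope.
Context {disp : Order.disp_t} {X : orderType disp}.
Implicit Types (x y w : X) (a b z : bm X) (i j : tri) (g h : aut X).
Context (Xhom : ultrahomogeneous X) (Xinf : ~ finite_set [set: X]).
Let Xdense := chain_denseP Xhom Xinf.
Local Notation R := Rdefinitions.R.

(** Equality of the order types of (s, g s) and (s, h s) yields [a] fixing [s] with a g = h on [s];
    then b = g^-1 a^-1 h fixes [s] as well, and h = a g b. *)
Lemma roelcke_close_type (s : seq X) g h :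
  (forall x y, x \in s -> y \in s ->
     cmp y (BPt (af g x) Ze) = cmp y (BPt (af h x) Ze)) -> roelcke_close s g h.
Proof.
move=> gh.
(* Identity on [s] and h g^-1 on g s; by [gs] the two prescriptions agree on the overlap. *)
pose k w := if w \in s then w else af h (ainv g w).
have gs x : x \in s -> af g x \in s -> af h x = af g x.
  by move=> xs gxs; have := gh _ _ xs gxs; rewrite cmp_eq => /esym/cmpZeP [].
have [|a aP] := @aut_extend _ _ Xhom (s ++ [seq af g x | x <- s]) k.
  move=> u v; rewrite !mem_cat /k.
  have [us _|us /= /mapP [x xs ->]] := boolP (u \in s);
      have [vs _|vs /= /mapP [y ys ->]] := boolP (v \in s) => //.
  - by rewrite af_can => uy; have := gh _ _ ys us; rewrite (cmp_gt _ uy) => /esym/cmpPlP [|[]].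
  - by rewrite af_can => xv; have := gh _ _ xs vs; rewrite (cmp_lt _ xv) => /esym/cmpMiP [|[]].
  - by rewrite !af_can !af_lt.
have aS : stab s a by move=> x xs; rewrite aP ?mem_cat ?xs // /k xs.
have ag x : x \in s -> af a (af g x) = af h x.
  move=> xs; rewrite aP ?mem_cat ?map_f ?orbT // /k.
  by case: ifP => [/(gs _ xs) ->//|_]; rewrite af_can.
have bK1 : cancel (ainv g \o ainv a \o af h) (ainv h \o af a \o af g).
  by move=> x /=; rewrite !ainv_can af_can.
have bK2 : cancel (ainv h \o af a \o af g) (ainv g \o ainv a \o af h).
  by move=> x /=; rewrite ainv_can !af_can.
have bM : {mono (ainv g \o ainv a \o af h) : x y / x <= y}.
  by move=> x y /=; rewrite !ainv_mono af_mono.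
exists a, (Aut bK1 bK2 bM); split => //; split=> [x xs|x] /=.
  by rewrite -ag // !af_can.
by rewrite !ainv_can.
Qed.

Lemma roelcke_close_cmp (s : seq X) g h x y : x \in s -> y \in s ->
  roelcke_close s g h -> cmp y (BPt (af g x) Ze) = cmp y (BPt (af h x) Ze).
Proof.
move=> xs ys [a [b [aS [bS hE]]]]; rewrite hE (bS _ xs) /=.
by rewrite -{3 4}(aS _ ys) !af_lt.
Qed.

(** Distinct positions get values at distance at least 1, so a real approximation determines the
    position. *)
Definition tri_val i : R := match i with Mi => 0 | Ze => 1 | Pl => 2 end%R.

Lemma tri_val_eq i j : (`|tri_val i - tri_val j| < 1)%R -> i = j.
Proof. by rewrite ltr_norml; case: i; case: j => /andP [H1 H2] //; exfalso; rewrite /= in H1 H2; lra. Qed.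

Definition cmp_fun x y g : R := tri_val (cmp y (BPt (af g x) Ze)).

Lemma cmp_fun_RUC x y : roelcke_uc (cmp_fun x y) /\ Defs.bounded_fun (cmp_fun x y).
Proof.
split=> [e e0|].
  exists [:: x; y] => g h gh; rewrite /cmp_fun (@roelcke_close_cmp _ g h x y _ _ gh).
  - by rewrite subrr normr0.
  - by rewrite inE eqxx.
  - by rewrite !inE eqxx orbT.
by exists 2%R => g; rewrite /cmp_fun; case: cmp; rewrite /= ger0_norm; lra.
Qed.

(** The position of g x at [y] depends only on the double coset of [g] for the stabiliser of x and
    y, hence is a coordinate of [b_r]. Near a point of the closure these positions are constant, and
    [cmp_realize] assembles them. *)
Lemma b_r_ge_e_X : cpt_ge (b_r X) (@e_X _ X).
Proof.
apply: (@cpt_ge_ptws _ (b_r X)) => x.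
pose P (p : cspace (b_r X)) z := forall y, exists W, nbhs p W /\
  forall g, W (cmap (b_r X) g) -> cmp y (BPt (af g x) Ze) = cmp y z.
have P_ex p : exists z, cclosure (b_r X) p -> P p z.
  have [cp|ncp] := pselect (cclosure (b_r X) p); last by exists (BPt x Ze).
  suff /choice [t tP] : forall y, exists i, exists W, nbhs p W /\
      forall g, W (cmap (b_r X) g) -> cmp y (BPt (af g x) Ze) = i.
    have [|z zt] := @cmp_realize _ _ t.
      move=> y w yw; have [W [nW WP]] := tP y; have [W' [nW' WP']] := tP w.
      have [g [/WP <- /WP' <-]] := clo_meet cp nW nW'; exact: cmp_mono.
    by exists z => _ y; have [W [nW WP]] := tP y; exists W; split => // g; rewrite zt => /WP.
  move=> y; pose u : RUC X := exist _ _ (cmp_fun_RUC x y).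
  (* Two values within 1/2 of p u differ by less than 1, so they encode the same position. *)
  have nW : nbhs p [set f : cspace (b_r X) | `|p u - f u| < 2^-1]%R.
    apply: ((R_cvg_dist (fun f : {ptws RUC X -> R} => f u) (p u) _).1 _ 2^-1%R); last by lra.
    exact: ptws_eval_continuous.
  have [g0 [g0W _]] := clo_meet cp nW nW.
  exists (cmp y (BPt (af g0 x) Ze)), [set f : cspace (b_r X) | `|p u - f u| < 2^-1]%R.
  split=> // g gW; apply: tri_val_eq.
  move: g0W gW; rewrite /= /cmp_fun !ltr_norml => /andP [? ?] /andP [? ?].
  by apply/andP; lra.
have [phi phiP] := choice P_ex.
exists phi; split; last first.
  move=> g; apply: (cmp_inj Xdense) => y.
  have [|W [nW WP]] := phiP (cmap (b_r X) g) _ y.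
    by apply: subset_closure; exists g.
  by rewrite -(WP g (nbhs_singleton nW)).
apply/within_continuousP => p cp.
apply: (bm_cvgP Xdense _ (fmap_filter _ (within_filter _ (nbhs_filter p)))).2 => y.
have [W [nW WP]] := phiP p cp y.
rewrite /nbhs /= /within /=; apply: filterS (nbhs_interior nW) => p' nW' cp'.
have [W' [nW'' WP']] := phiP p' cp' y.
have [g [gW gW']] := clo_meet cp' nW' nW''.
by rewrite /= -(WP _ gW) -(WP' _ gW').
Qed.

(** A Roelcke uniformly continuous function varies little on double cosets, which are traces of open
    sets of [e_X]; hence it is Cauchy along the neighbourhoods of a point of the closure and
    converges. *)
Lemma e_X_ge_b_r : cpt_ge (@e_X _ X) (b_r X).
Proof.
apply: (@cpt_ge_ptws _ (@e_X _ X)) => -[u [uR uB]].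
pose C := @e_X _ X.
pose P (p : cspace C) (v : R) := forall e : R, (0 < e)%R -> exists W, nbhs p W /\
  forall g, W (cmap C g) -> (`|v - u g| < e)%R.
have P_ex p : exists v, cclosure C p -> P p v.
  have [cp|ncp] := pselect (cclosure C p); last by exists 0%R.
  pose F : set_system R := filter_from (nbhs p) (fun W => [set u g | g in [set g | W (cmap C g)]]).
  have FF : ProperFilter F.
    apply: filter_from_proper; last first.
      by move=> W nW; have [g [Wg _]] := clo_meet cp nW nW; exists (u g), g.
    apply: filter_from_filter; first by exists setT; exact: filterT.
    move=> W W' nW nW'; exists (W `&` W'); first exact: filterI.
    by move=> _ [g [Wg W'g] <-]; split; exists g.
  have [e /uR [s sP]|v vP] := real_cauchy_lim FF.
    (* Any two automorphisms in [W] have the same order type over [s], so they are Roelcke close. *)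
    pose W := [set f : cspace C | forall x y, x \in s -> y \in s -> cmp y (f x) = cmp y (p x)].
    have nW : nbhs p W.
      have H x : nbhs p [set f : cspace C | forall y, y \in s -> cmp y (f x) = cmp y (p x)].
        apply: (@ptws_eval_continuous X (bm X) x p [set a | forall y, y \in s -> cmp y a = cmp y (p x)]).
        by apply: (@cmp_near _ _ (nbhs (p x))) => y; apply: open_nbhs_nbhs; split => //; exact: cmp_open.
      suff Hl (l : seq X) : nbhs p [set f : cspace C |
          forall x y, x \in l -> y \in s -> cmp y (f x) = cmp y (p x)] by exact: Hl.
      elim: l => [|x l IH]; first by apply: filterS filterT.
      apply: filterS2 (H x) IH => f fx fl w y.
      by rewrite inE => /orP [/eqP ->|wl] ys; [exact: fx|exact: fl].
    have [g0 [g0W _]] := clo_meet cp nW nW.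
    exists (u g0), W => // _ [g gW <-]; rewrite /=; apply: sP.
    by apply: roelcke_close_type => x y xs ys; rewrite (gW _ _ xs ys) (g0W _ _ xs ys).
  exists v => _ e e0; have [W nW WP] := vP e e0.
  by exists W; split => // g gW; apply: WP; exists g.
have [phi phiP] := choice P_ex.
exists phi; split; last first.
  move=> g; apply/eqP; rewrite -subr_eq0 -normr_le0 leNgt; apply/negP => n0.
  have [|W [nW WP]] := phiP (cmap C g) _ _ n0; first by apply: subset_closure; exists g.
  by have := WP g (nbhs_singleton nW); rewrite ltxx.
apply/within_continuousP => p cp; apply/R_cvg_dist => e e0.
have e2 : (0 < e / 2)%R by rewrite divr_gt0.
have [W [nW WP]] := phiP p cp _ e2.
rewrite /within /=; apply: filterS (nbhs_interior nW) => p' nW' cp'.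
have [W' [nW'' WP']] := phiP p' cp' _ e2.
have [g [gW gW']] := clo_meet cp' nW' nW''.
have := WP _ gW; have := WP' _ gW'; rewrite !ltr_norml => /andP [? ?] /andP [? ?].
by apply/andP; lra.
Qed.

End Roelcke.

(** * Refuting comparisons by squeezing *)

Section Separation.
Local Open Scope order_scope.
Local Open Scope classical_set_scope.
Context {disp : Order.disp_t} {X : orderType disp}.
Implicit Types (x y w c : X) (a b z : bm X) (i j : tri) (g : aut X).
Context (Xhom : ultrahomogeneous X) (Xinf : ~ finite_set [set: X]).
Let Xdense := chain_denseP Xhom Xinf.
Let Xmin := chain_nominP Xhom Xinf.
Let Xmax := chain_nomaxP Xhom Xinf.

Lemma cut_inf : is_cut (set0 : set X).
Proof. by split=> // b _; have [a ab] := Xmin b; exists a; split. Qed.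

Lemma cut_sup : is_cut [set: X].
Proof.
split=> [//|a _|b nb]; last by case: nb.
by have [b ab] := Xmax a; exists b.
Qed.

Definition bm_inf : bm X := BGap (Gap cut_inf).
Definition bm_sup : bm X := BGap (Gap cut_sup).

Lemma cmp_inf y : cmp y bm_inf = Mi.
Proof. by rewrite /=; case: asboolP. Qed.

Lemma cmp_sup y : cmp y bm_sup = Pl.
Proof. by rewrite /=; case: asboolP. Qed.

Lemma cmp_side x i y : i <> Ze -> cmp y (BPt x i) <> Ze.
Proof. by move=> H /cmpZeP [_ /H]. Qed.

Lemma cmp_neq_open y i : open [set a | cmp y a <> i].
Proof.
rewrite (_ : [set _ | _] = \bigcup_(j in [set j | j <> i]) [set a | cmp y a = j]).
  by apply: bigcup_open => j _; exact: cmp_open.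
rewrite eqEsubset; split=> a /=; first by move=> H; exists (cmp y a).
by move=> [j /= ji ->].
Qed.

Lemma inf_const_proper : ProperFilter (approx_filter (bm_const bm_inf)).
Proof.
by apply: approx_filter_proper => //; apply: bm_const_incr => y; rewrite cmp_inf.
Qed.

Lemma sup_const_proper : ProperFilter (approx_filter (bm_const bm_sup)).
Proof.
by apply: approx_filter_proper => //; apply: bm_const_incr => y; rewrite cmp_sup.
Qed.

Lemma side_const_proper x i : i <> Ze ->
  ProperFilter (approx_filter (bm_const (BPt x i))).
Proof.
move=> H; apply: approx_filter_proper => //; apply: bm_const_incr => y.
exact: cmp_side.
Qed.

Definition act_limit z a : bm X := if `[< bm_end a >] then a else z.

Lemma kquot_const_cvg (K : Type) (k : bm X -> K) z : (forall y, cmp y z <> Ze) ->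
  cmap (ecpt (kact (@bm_act _ X) (k := k))) @ approx_filter (bm_const z) -->
    ((fun q => kpi k (act_limit z (krepr q))) : {ptws kquot k -> kquot k}).
Proof.
move=> zP; apply/ptws_cvgP => q.
exact: cvg_comp (@act_const_cvg _ _ Xhom Xinf _ zP (krepr q)) (@kpi_continuous _ _ k _).
Qed.

Lemma e_X_cvg f : cmap (@e_X _ X) @ approx_filter f --> (f : {ptws X -> bm X}).
Proof. by apply/ptws_cvgP => x; exact: approx_pt_cvg. Qed.

Definition alpha_limit (f : X -> bm X) : {ptws aX X -> aX X} :=
  fun p => if p is Some x then bm_alpha (f x) else None.

Lemma e_alpha_cvg f : cmap (e_alpha X) @ approx_filter f --> alpha_limit f.
Proof.
apply/ptws_cvgP => -[x|]; last exact: cvg_cst.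
exact: (cvg_comp _ _ (@approx_pt_cvg _ _ Xhom Xinf f x) (@bm_alpha_continuous _ X _)).
Qed.

Lemma kquot_eval (K : Type) (k : bm X -> K) (V : set (bm X)) g a : equivariant k ->
  (forall b b', k b = k b' -> V b -> V b') ->
  V (krepr (kact (k := k) (@bm_act _ X) g (kpi k a))) -> V (bm_act g a).
Proof. by move=> ek sV; rewrite kact_kpi //; apply: sV; exact: krepr_kpi. Qed.

Lemma cmp_cover (b b' : X) a : b < b' -> cmp b a = Pl \/ cmp b' a = Mi.
Proof.
move=> bb'; have [->|H] := pselect (cmp b' a = Mi); [by right|left].
exact: cmp_mono H.
Qed.

(** These rays contain all or none of the three points over each element of [X], so they are
    saturated for [bm_flip], unlike the sets of [cmp_cover]. *)
Lemma pt_cover (b b' : X) a : b < b' -> bm_lt (BPt b Pl) a \/ bm_lt a (BPt b' Mi).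
Proof.
move=> bb'; have [c bc cb'] := Xdense bb'; have [d cd db'] := Xdense cb'.
have [H|H] := cmp_cover a cd; [left|right].
  exact: bm_lt_trans_cmp' H bc.
exact: bm_lt_trans_cmp H db'.
Qed.

Lemma gt_cmp (b : X) a : bm_lt (BPt b Pl) a -> cmp b a = Pl.
Proof. by move=> H; apply/cmpPlP; case: a H => //= x i [|[]] //; left. Qed.

Lemma lt_cmp (b : X) a : bm_lt a (BPt b Mi) -> cmp b a = Mi.
Proof. by move=> H; apply/cmpMiP; case: a H => //= x [] [|[]] //; left. Qed.

(** Squeezing towards [bm_inf] and towards [bm_sup] has the same limit once the ends are identified,
    but different positions in [e_X]. *)
Lemma not_e_lr_ge_e_X : ~ cpt_ge (e_lr X) (@e_X _ X).
Proof.
have [b [b' bb']] := chain_lt_ex Xinf.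
have E : (fun q : bLR X => kpi (@k_lr _ X) (act_limit bm_sup (krepr q))) =
         (fun q => kpi (@k_lr _ X) (act_limit bm_inf (krepr q))).
  apply/funext => q; apply: kpi_eq; rewrite /act_limit; case: asboolP => // _.
  by rewrite /k_lr !asboolT //=; [left|right].
apply: (@not_cpt_ge_ptws _ (e_lr X) X (bm X) _ _ _ _ b [set a | cmp b a = Pl]
  [set a | cmp b' a = Mi] inf_const_proper sup_const_proper).
- by apply: kquot_const_cvg => y; rewrite cmp_inf.
- by have := @kquot_const_cvg _ (@k_lr _ X) bm_sup; rewrite E; apply => y; rewrite cmp_sup.
- exact: cmp_open.
- exact: cmp_open.
- by move=> a; exact: cmp_cover.
- apply: filterS (approx_filterP _ b b) => g + E1; rewrite /mkset cmp_inf.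
  by rewrite (E1 : cmp b (BPt (af g b) Ze) = Pl).
- apply: filterS (approx_filterP _ b b') => g + E1; rewrite /mkset cmp_sup.
  by rewrite (E1 : cmp b' (BPt (af g b) Ze) = Mi).
Qed.

Lemma act_limit_flip x a :
  bm_flip (act_limit (BPt x Pl) a) = bm_flip (act_limit (BPt x Mi) a).
Proof. by rewrite /act_limit; case: asboolP. Qed.

(** Squeezing towards (x, -1) and (x, 1) is indistinguishable once these are identified, but puts g
    x on different sides of x. *)
Lemma not_e_ud_ge_e_X : ~ cpt_ge (e_ud X) (@e_X _ X).
Proof.
have [x _] := chain_fresh Xinf [::].
have E : (fun q : bUD X => kpi (@k_ud _ X) (act_limit (BPt x Pl) (krepr q))) =
         (fun q => kpi (@k_ud _ X) (act_limit (BPt x Mi) (krepr q))).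
  by apply/funext => q; apply: kpi_eq; exact: act_limit_flip.
have PM : ProperFilter (approx_filter (bm_const (BPt x Mi))) by exact: side_const_proper.
have PP : ProperFilter (approx_filter (bm_const (BPt x Pl))) by exact: side_const_proper.
apply: (@not_cpt_ge_ptws _ (e_ud X) X (bm X) _ _ _ _ x [set a | cmp x a <> Mi]
  [set a | cmp x a <> Pl] PM PP).
- by apply: kquot_const_cvg => y; exact: cmp_side.
- have := @kquot_const_cvg _ (@k_ud _ X) (BPt x Pl); rewrite E; apply => y.
  exact: cmp_side.
- exact: cmp_neq_open.
- exact: cmp_neq_open.
- by move=> a /=; case: cmp; [right|left|left].
- by apply: filterS (approx_filterP _ x x) => g H; apply; rewrite H; exact: cmp_eq.
- by apply: filterS (approx_filterP _ x x) => g H; apply; rewrite H; exact: cmp_eq.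
Qed.

(** The two-sided squeeze at x again; the separating cover must now respect the identification of
    the ends. *)
Lemma not_e_plus_ge_e_lr : ~ cpt_ge (e_plus X) (e_lr X).
Proof.
have [x _] := chain_fresh Xinf [::]; have [b bx] := Xmin x; have [c xc] := Xmax x.
have E : (fun q : bPlus X => kpi (@k_plus _ X) (act_limit (BPt x Pl) (krepr q))) =
         (fun q => kpi (@k_plus _ X) (act_limit (BPt x Mi) (krepr q))).
  apply/funext => q; apply: kpi_eq; rewrite /k_plus act_limit_flip.
  by rewrite /act_limit; case: (asboolP (bm_end (krepr q))) => // _; rewrite !asboolF.
have PM : ProperFilter (approx_filter (bm_const (BPt x Mi))) by exact: side_const_proper.
have PP : ProperFilter (approx_filter (bm_const (BPt x Pl))) by exact: side_const_proper.
(* The second pieces add the missing end to each set, making it saturated; as b < x < c, they stay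
   away from the squeezed points. *)
pose V1 := [set a | cmp x a <> Mi] `|` [set a | cmp b a = Mi].
pose V2 := [set a | cmp x a <> Pl] `|` [set a | cmp c a = Pl].
have sat (V : set (bm X)) : (forall a, bm_end a -> V a) ->
    forall a a', k_lr a = k_lr a' -> V a -> V a'.
  move=> VE a a'; rewrite /k_lr; case: asboolP; case: asboolP => // H _.
    by move=> _ _; exact: VE.
  by move=> [->].
have s1 : forall a a', k_lr a = k_lr a' -> V1 a -> V1 a'.
  apply: sat => -[//|A] /= [] H; [right|left]; rewrite /V1 /= H;
    by case: asboolP => // H'; case: H'.
have s2 : forall a a', k_lr a = k_lr a' -> V2 a -> V2 a'.
  apply: sat => -[//|A] /= [] H; [left|right]; rewrite /V2 /= H;
    by case: asboolP => // H'; case: H'.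
apply: (@not_cpt_ge_ptws _ (e_plus X) _ (bLR X) _ _ _ _ (kpi _ (BPt x Ze))
  [set q | V1 (krepr q)] [set q | V2 (krepr q)] PM PP).
- by apply: kquot_const_cvg => y; exact: cmp_side.
- have := @kquot_const_cvg _ (@k_plus _ X) (BPt x Pl); rewrite E; apply => y.
  exact: cmp_side.
- by apply: kquot_open s1; apply: openU; [exact: cmp_neq_open|exact: cmp_open].
- by apply: kquot_open s2; apply: openU; [exact: cmp_neq_open|exact: cmp_open].
- by move=> q; case E1 : (cmp x (krepr q)); [right|left|left]; left; rewrite /mkset E1.
- apply: filterS2 (approx_filterP _ x x) (approx_filterP _ x b) => g H1 H2.
  have {}H1 : cmp x (BPt (af g x) Ze) = Mi by rewrite H1; exact: cmp_eq.
  have {}H2 : cmp b (BPt (af g x) Ze) = Pl by rewrite H2; exact: cmp_gt.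
  move=> /(kquot_eval (@k_lr_equiv _ X) s1) [E1|E1]; first exact: E1 H1.
  by move: H2; rewrite (E1 : cmp b (BPt (af g x) Ze) = Mi).
- apply: filterS2 (approx_filterP _ x x) (approx_filterP _ x c) => g H1 H2.
  have {}H1 : cmp x (BPt (af g x) Ze) = Pl by rewrite H1; exact: cmp_eq.
  have {}H2 : cmp c (BPt (af g x) Ze) = Mi by rewrite H2; exact: cmp_lt.
  move=> /(kquot_eval (@k_lr_equiv _ X) s2) [E1|E1]; first exact: E1 H1.
  by move: H2; rewrite (E1 : cmp c (BPt (af g x) Ze) = Pl).
Qed.

Lemma flip_gt (b : X) a : bm_lt (BPt b Pl) (bm_flip a) <-> bm_lt (BPt b Pl) a.
Proof. by case: a => // x [] //=; split; case=> [|[? ?]] //; left. Qed.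

Lemma flip_lt (b : X) a : bm_lt (bm_flip a) (BPt b Mi) <-> bm_lt a (BPt b Mi).
Proof. by case: a => // x [] //=; split; case=> [|[? ?]] //; left. Qed.

(** The squeezes towards the two ends are merged in [bPlus], while rays saturated for the flip keep
    them apart in [bUD]. *)
Lemma not_e_plus_ge_e_ud : ~ cpt_ge (e_plus X) (e_ud X).
Proof.
have [b [b' bb']] := chain_lt_ex Xinf.
have E : (fun q : bPlus X => kpi (@k_plus _ X) (act_limit bm_sup (krepr q))) =
         (fun q => kpi (@k_plus _ X) (act_limit bm_inf (krepr q))).
  apply/funext => q; apply: kpi_eq; rewrite /act_limit; case: asboolP => // _.
  by rewrite /k_plus !asboolT //=; [left|right].
have s1 a a' : k_ud a = k_ud a' -> bm_lt (BPt b Pl) a -> bm_lt (BPt b Pl) a'.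
  by rewrite /k_ud => E1 /flip_gt; rewrite E1 => /flip_gt.
have s2 a a' : k_ud a = k_ud a' -> bm_lt a (BPt b' Mi) -> bm_lt a' (BPt b' Mi).
  by rewrite /k_ud => E1 /flip_lt; rewrite E1 => /flip_lt.
apply: (@not_cpt_ge_ptws _ (e_plus X) _ (bUD X) _ _ _ _ (kpi _ (BPt b Ze))
  [set q | bm_lt (BPt b Pl) (krepr q)] [set q | bm_lt (krepr q) (BPt b' Mi)]
  inf_const_proper sup_const_proper).
- by apply: kquot_const_cvg => y; rewrite cmp_inf.
- by have := @kquot_const_cvg _ (@k_plus _ X) bm_sup; rewrite E; apply => y; rewrite cmp_sup.
- by apply: kquot_open s1; exact: (bm_gt_open (BPt b Pl)).
- by apply: kquot_open s2; exact: (bm_lt_open (BPt b' Mi)).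
- by move=> q; exact: pt_cover.
- apply: filterS (approx_filterP _ b b) => g H.
  by move=> /(kquot_eval (@k_ud_equiv _ X) s1) /gt_cmp; rewrite H cmp_inf.
- apply: filterS (approx_filterP _ b b') => g H.
  by move=> /(kquot_eval (@k_ud_equiv _ X) s2) /lt_cmp; rewrite H cmp_sup.
Qed.

Lemma k_plus_sat (V : set (bm X)) : (forall a, V (bm_flip a) <-> V a) ->
  (forall a a', bm_end a -> bm_end a' -> V a -> V a') ->
  forall a a', k_plus a = k_plus a' -> V a -> V a'.
Proof.
move=> VF VE a a'; rewrite /k_plus; case: asboolP => H; case: asboolP => // H'.
  by move=> _; exact: VE.
by case=> E /VF; rewrite E => /VF.
Qed.

(* Two open saturated sets covering [bPlus X], avoiding respectively the interval
   from [y2] to [y3] and a neighbourhood of the point [inf ~ sup]. *)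
Definition off (y2 y3 : X) : set (bm X) :=
  [set a | bm_lt a (BPt y2 Mi)] `|` [set a | bm_lt (BPt y3 Pl) a].
Definition within_pts (y1 y4 : X) : set (bm X) :=
  [set a | bm_lt (BPt y1 Pl) a] `&` [set a | bm_lt a (BPt y4 Mi)].

Lemma off_sat y2 y3 a a' : k_plus a = k_plus a' -> off y2 y3 a -> off y2 y3 a'.
Proof.
apply: k_plus_sat => [{}a|{}a {}a'].
  by rewrite /off; split; case=> H; [left|right|left|right];
    apply/flip_lt || apply/flip_gt.
by case: a a' => [//|A] [//|A'] _ /= [] H _; [left|right]; rewrite /= H.
Qed.

Lemma within_pts_sat y1 y4 a a' :
  k_plus a = k_plus a' -> within_pts y1 y4 a -> within_pts y1 y4 a'.
Proof.
apply: k_plus_sat => [{}a|{}a {}a'].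
  by rewrite /within_pts; split; case=> H H'; split;
    apply/flip_lt || apply/flip_gt.
by case: a => [//|A] /= [] H _ [] /=; rewrite H.
Qed.

Lemma off_open y2 y3 : open (off y2 y3).
Proof. by apply: openU; [exact: bm_lt_open|exact: bm_gt_open]. Qed.

Lemma within_pts_open y1 y4 : open (within_pts y1 y4).
Proof. by apply: openI; [exact: bm_gt_open|exact: bm_lt_open]. Qed.

Lemma off_within_cover y1 y2 y3 y4 a : y1 < y2 -> y3 < y4 ->
  off y2 y3 a \/ within_pts y1 y4 a.
Proof.
move=> y12 y34; have [H1|H1] := pt_cover a y12; last by left; left.
by have [H2|H2] := pt_cover a y34; [left; right|right].
Qed.

Lemma not_off y2 y3 a : cmp y2 a = Pl -> cmp y3 a = Mi -> ~ off y2 y3 a.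
Proof. by move=> H2 H3 [/lt_cmp|/gt_cmp]; rewrite ?H2 ?H3. Qed.

Lemma five_points : exists y1 y2 c y3 y4, [/\ y1 < y2, y2 < c, c < y3 & y3 < y4].
Proof.
have [y1 _] := chain_fresh Xinf [::]; have [y2 H1] := Xmax y1.
have [c H2] := Xmax y2; have [y3 H3] := Xmax c; have [y4 H4] := Xmax y3.
by exists y1, y2, c, y3, y4.
Qed.

(** Every squeeze becomes the constant infinity in [e_alpha], whereas squeezing to (c, -1) and to
    [bm_inf] gives different limits in [bPlus]. *)
Lemma not_e_alpha_ge_e_plus : ~ cpt_ge (e_alpha X) (e_plus X).
Proof.
have [y1 [y2 [c [y3 [y4 [H12 H2 H3 H34]]]]]] := five_points.
have PM : ProperFilter (approx_filter (bm_const (BPt c Mi))) by exact: side_const_proper.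
apply: (@not_cpt_ge_ptws _ (e_alpha X) _ (bPlus X) _ _ _ _ (kpi _ (BPt c Ze))
  [set q | off y2 y3 (krepr q)] [set q | within_pts y1 y4 (krepr q)]
  PM inf_const_proper).
- exact: e_alpha_cvg.
- exact: e_alpha_cvg.
- by apply: kquot_open (@off_sat _ _); exact: off_open.
- by apply: kquot_open (@within_pts_sat _ _); exact: within_pts_open.
- by move=> q; exact: off_within_cover.
- apply: filterS2 (approx_filterP _ c y2) (approx_filterP _ c y3) => g E2 E3.
  move=> /(kquot_eval (@k_plus_equiv _ X) (@off_sat _ _)); apply: not_off.
    by rewrite [LHS]E2; exact: cmp_gt.
  by rewrite [LHS]E3; exact: cmp_lt.
- apply: filterS (approx_filterP _ c y1) => g E1.
  move=> /(kquot_eval (@k_plus_equiv _ X) (@within_pts_sat _ _)) [/gt_cmp E _].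
  by move: E1; rewrite /mkset cmp_inf (E : cmp y1 (BPt (af g c) Ze) = Pl).
Qed.

(* Automorphisms squeezing everything below [w] to just below [c], everything
   above [w] to the top, and sending [w] to [y]. With [w] on either side of a
   proper gap they agree in the limit on [X] but not at the gap. *)
Definition step_fun c w y x : bm X :=
  if x < w then BPt c Mi else if x == w then BPt y Ze else bm_sup.

Lemma step_fun_incr c w y : c <= y -> bm_incr (step_fun c w y).
Proof.
move=> cy x x' u xx'; rewrite /step_fun.
case: (ltgtP x w) => [xw|wx|xw].
- case: ltgtP => [x'w|wx'|x'w] H; rewrite ?cmp_sup //.
    by case E : (cmp u (BPt c Mi)) H => // _; case/cmpZeP: E.
  have uc : u < c by move: H => /=; case: ltgtP.
  by rewrite (cmp_gt _ (lt_le_trans uc cy)).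
- by rewrite ltNge (ltW (lt_trans wx xx')) /= (gt_eqF (lt_trans wx xx')) cmp_sup.
- by rewrite -xw ltNge (ltW xx') /= (gt_eqF xx') cmp_sup.
Qed.

Lemma not_e_X_ge_e_plus : ~ continuously_ordered X -> ~ cpt_ge (@e_X _ X) (e_plus X).
Proof.
move=> nco.
(* Density is automatic, so the failure of continuity produces a proper gap. *)
have [A [A0 AT]] : exists A : gap X, (exists x, gset A x) /\ (exists x, ~ gset A x).
  apply: contrapT => H; apply: nco; split=> [a b /Xdense [c ac cb]|A]; first by exists c.
  have [Ax|nA] := pselect (exists x, gset A x); [right|left].
    rewrite eqEsubset; split=> // x _; apply: contrapT => Ax'; apply: H.
    by exists A; split => //; exists x.
  by rewrite eqEsubset; split=> x // Ax; apply: nA; exists x.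
have [a0 Aa0] := A0; have [a1 Aa1] := AT.
have [y1 [y2 [c [y3 [y4 [H12 H2 H3 H34]]]]]] := five_points.
(* The common limit on [X]: below the gap everything goes to (c, -1), above it to the top. *)
pose f0 x : bm X := if `[< gset A x >] then BPt c Mi else bm_sup.
have stepE (s : seq X) w y g : (forall x, x \in s -> gset A x -> x < w) ->
    (forall x, x \in s -> ~ gset A x -> w < x) ->
    approximates (step_fun c w y) s g -> approximates f0 s g.
  move=> lo hi gP x u xs us; rewrite gP // /step_fun /f0; case: asboolP => Ax.
    by rewrite lo.
  by have wx := hi _ xs Ax; rewrite ltNge (ltW wx) /= (gt_eqF wx).
(* The point [w] depends on the neighbourhood of [f0], so no single step function, hence no single
   approximation filter, serves here. *)
apply: (@not_cpt_ge _ (@e_X _ X) (e_plus X) (f0 : {ptws X -> bm X})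
  [set h : {ptws bPlus X -> bPlus X} | off y2 y3 (krepr (h (kpi _ (BGap A))))]
  [set h : {ptws bPlus X -> bPlus X} | within_pts y1 y4 (krepr (h (kpi _ (BGap A))))]).
- apply: (@open_comp _ _ (fun h : {ptws bPlus X -> bPlus X} => h (kpi _ (BGap A)))
    [set q | off y2 y3 (krepr q)]); first by move=> h _; exact: ptws_eval_continuous.
  by apply: kquot_open (@off_sat _ _); exact: off_open.
- apply: (@open_comp _ _ (fun h : {ptws bPlus X -> bPlus X} => h (kpi _ (BGap A)))
    [set q | within_pts y1 y4 (krepr q)]); first by move=> h _; exact: ptws_eval_continuous.
  by apply: kquot_open (@within_pts_sat _ _); exact: within_pts_open.
- by move=> h; exact: off_within_cover.
- move=> W /(e_X_cvg (f := f0)) [s _ sW].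
  (* With [w] just above the gap and sent to c, the moved gap lies between the image of [a0], which
     is above [y2], and c < [y3]. *)
  have [w Aw wP] : exists2 w, ~ gset A w & forall x, x \in s -> ~ gset A x -> w < x.
    have [E|[m mU mP]] := seq_has_min [seq x <- s | `[< ~ gset A x >]].
      exists a1 => // x xs Ax.
      have : x \in [seq x <- s | `[< ~ gset A x >]] by rewrite mem_filter xs asboolT.
      by rewrite E.
    move: mU; rewrite mem_filter => /andP [/asboolP Am ms].
    have [w Aw wm] := gap_dn Am; exists w => // x xs Ax.
    by apply: lt_le_trans wm (mP _ _); rewrite mem_filter xs asboolT.
  have [g gP] := approx_ex Xhom Xinf ([:: w; c; y2; a0] ++ s) (@step_fun_incr c w c (lexx c)).
  exists g.
    apply: sW; apply: (@stepE _ w c) => // [x _ Ax|]; first exact: gap_lt Ax Aw.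
    by apply: approxS gP => x xs; rewrite mem_cat xs orbT.
  move=> /(kquot_eval (@k_plus_equiv _ X) (@off_sat _ _)).
  have a0w := gap_lt Aa0 Aw.
  have /cmpPlP /= [|[]//] : cmp y2 (BPt (af g a0) Ze) = Pl.
    rewrite gP ?inE ?eqxx ?orbT // /step_fun a0w; exact: cmp_gt.
  move=> y2g.
  have /cmpZeP [gw] : cmp c (BPt (af g w) Ze) = Ze.
    rewrite gP ?inE ?eqxx ?orbT // /step_fun ltxx eqxx; exact: cmp_eq.
  case=> /=.
    apply; apply: gap_down Aa0 _; apply: ltW.
    by rewrite -(af_lt g) ainv_can.
  move=> Ay3; have := gap_lt Ay3 Aw; rewrite -(af_lt g) ainv_can gw.
  by move=> /(lt_trans H3); rewrite ltxx.
- move=> W /(e_X_cvg (f := f0)) [s _ sW].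
  (* With [w] just below the gap and sent to [y4], the moved gap lies above [y4]. *)
  have [w Aw wP] : exists2 w, gset A w & forall x, x \in s -> gset A x -> x < w.
    have [E|[m mU mP]] := seq_has_max [seq x <- s | `[< gset A x >]].
      exists a0 => // x xs Ax.
      have : x \in [seq x <- s | `[< gset A x >]] by rewrite mem_filter xs asboolT.
      by rewrite E.
    move: mU; rewrite mem_filter => /andP [/asboolP Am ms].
    have [w Aw wm] := gap_up Am; exists w => // x xs Ax.
    by apply: le_lt_trans (mP _ _) wm; rewrite mem_filter xs asboolT.
  have cy4 : c <= y4 by exact: ltW (lt_trans H3 H34).
  have [g gP] := approx_ex Xhom Xinf ([:: w; y4] ++ s) (@step_fun_incr c w y4 cy4).
  exists g.
    apply: sW; apply: (@stepE _ w y4) => // [x _ Ax|]; first exact: gap_lt Aw Ax.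
    by apply: approxS gP => x xs; rewrite mem_cat xs orbT.
  move=> /(kquot_eval (@k_plus_equiv _ X) (@within_pts_sat _ _)) [_] /=.
  have /cmpZeP [gw] : cmp y4 (BPt (af g w) Ze) = Ze.
    rewrite gP ?inE ?eqxx ?orbT // /step_fun ltxx eqxx; exact: cmp_eq.
  by apply; rewrite -gw af_can.
Qed.

End Separation.

(** * Rees quotients of the enveloping semigroup over [aX] *)

Section Rees.
Local Open Scope order_scope.
Local Open Scope classical_set_scope.
Context {disp : Order.disp_t} {X : orderType disp}.
Implicit Types (x y w : X) (g : aut X) (t : seq X).
Context (Xhom : ultrahomogeneous X) (Xinf : ~ finite_set [set: X]).
Let Xdense := chain_denseP Xhom Xinf.

(* A limit of automorphisms fixing exactly the points of [t]; outside [t] it takes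
   values [(m, 1)], [m] the last point of [t] below, or [inf]. *)
Lemma fix_limit_ex t : exists f : X -> bm X, [/\ bm_incr f,
  forall x, x \in t -> f x = BPt x Ze & forall x, x \notin t -> bm_alpha (f x) = None].
Proof.
pose below x y := exists2 m, m \in t & m < x /\ y <= m.
have H x : exists z : bm X, (x \in t -> z = BPt x Ze) /\
    (x \notin t -> forall y, cmp y z = if `[< below x y >] then Pl else Mi).
  have [xt|xt] := boolP (x \in t); first by exists (BPt x Ze).
  have [|z zP] := @cmp_realize _ _ (fun y => if `[< below x y >] then Pl else Mi).
    move=> y w yw; case: asboolP => // -[m mt [mx wm]] _; rewrite asboolT //.
    by exists m => //; split => //; exact: ltW (lt_le_trans yw wm).
  by exists z.
have [f fP] := choice H; exists f; split=> [x x' y xx'|x xt|x xt].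
- have [xt|xt] := boolP (x \in t); have [x't|x't] := boolP (x' \in t).
  + rewrite (fP x).1 // (fP x').1 // => cx; apply: cmp_gt; apply: le_lt_trans xx'.
    by rewrite leNgt; apply/negP => xy; apply: cx; exact: cmp_lt.
  + rewrite (fP x).1 // (fP x').2 // => cx; rewrite asboolT //; exists x => //.
    by split => //; rewrite leNgt; apply/negP => xy; apply: cx; exact: cmp_lt.
  + rewrite (fP x).2 // (fP x').1 //; case: asboolP => // -[m mt [mx ym]] _.
    exact: cmp_gt (le_lt_trans ym (lt_trans mx xx')).
  + rewrite (fP x).2 // (fP x').2 //; case: asboolP => // -[m mt [mx ym]] _.
    by rewrite asboolT //; exists m => //; split => //; exact: lt_trans xx'.
- exact: (fP x).1.
- case E : (bm_alpha (f x)) => [w|//].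
  have := (fP x).2 xt w; rewrite (bm_alpha_pt E) cmp_eq.
  by case: asboolP.
Qed.

Lemma alpha_pt_open x : open [set p : aX X | p = Some x].
Proof.
rewrite openE => _ /= ->; rewrite /interior.
suff : nbhs (x : discrete_topology X) (Some @^-1` [set p | p = Some x]) by [].
by apply: (filterS _ (@discrete_set1 (discrete_topology X) x)) => _ ->.
Qed.

Lemma alpha_pt_closed x : open [set p : aX X | p <> Some x].
Proof.
rewrite openE => -[y|] /= yx; rewrite /interior.
  suff : nbhs (y : discrete_topology X) (Some @^-1` [set p | p <> Some x]) by [].
  by apply: (filterS _ (@discrete_set1 (discrete_topology X) y)) => _ ->.
exists ([set x] : set (discrete_topology X)).
  by split; [exact: compact_set1|exact: discrete_closed].
by move=> p [[y /= yx' <-] [E]|-> //]; apply: yx'.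
Qed.

(** A clopen condition, so it and its complement form the cover used for separation. *)
Definition fixes t : set {ptws aX X -> aX X} :=
  [set f | forall x, x \in t -> f (Some x) = Some x].

Lemma fixes_open t : open (fixes t).
Proof.
rewrite openE => f ft; rewrite /interior.
suff H (l : seq X) : {subset l <= t} ->
    nbhs f [set h : {ptws aX X -> aX X} | forall x, x \in l -> h (Some x) = Some x].
  exact: H.
elim: l => [|x l IH] lt; first by apply: filterS filterT.
have Hx : nbhs f [set h : {ptws aX X -> aX X} | h (Some x) = Some x].
  apply: (@ptws_eval_continuous (aX X) (aX X) (Some x) f [set p | p = Some x]).
  apply: open_nbhs_nbhs; split; first exact: alpha_pt_open.
  by apply: ft; apply: lt; exact: mem_head.
apply: filterS2 Hx (IH _) => [h hx hl y|y yl]; last by apply: lt; rewrite inE yl orbT.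
by rewrite inE => /orP [/eqP ->//|]; exact: hl.
Qed.

Lemma fixes_closed t : open (~` fixes t).
Proof.
rewrite (_ : ~` _ = \bigcup_(x in [set` t])
    [set f : {ptws aX X -> aX X} | f (Some x) <> Some x]).
  apply: bigcup_open => x _.
  apply: (@open_comp _ _ (fun h : {ptws aX X -> aX X} => h (Some x)) [set p | p <> Some x]).
    by move=> h _; exact: ptws_eval_continuous.
  exact: alpha_pt_closed.
rewrite eqEsubset; split=> f /=; last by move=> [x xt fx] H; apply: fx; exact: H.
by move=> /existsNP [x /not_implyP [xt fx]]; exists x.
Qed.

Lemma cvg_closure (F : set_system (aut X)) (C : cpt (aut X)) p :
  ProperFilter F -> cmap C @ F --> p -> closure (range (cmap C)) p.
Proof.
move=> PF Fp W /Fp FW.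
have [g Wg] := filter_ex (FW : F [set g | W (cmap C g)]).
by exists (cmap C g); split => //; exists g.
Qed.

(* [rees m] cannot tell an element of [J m] fixing the points of [t] from the
   constant [infinity], that is, the zero. *)
Lemma not_rees_ge t m (C : cpt (aut X)) (U1 U2 : set (cspace C)) :
  t != [::] -> (size t <= m)%N -> open U1 -> open U2 -> (forall z, U1 z \/ U2 z) ->
  (forall g, U1 (cmap C g) -> ~ fixes t (cmap (e_alpha X) g)) ->
  (forall g, U2 (cmap C g) -> fixes t (cmap (e_alpha X) g)) ->
  ~ cpt_ge (rees X m) C.
Proof.
move=> t0 tm o1 o2 U12 U1P U2P.
have [f [fI ft fnt]] := fix_limit_ex t.
have PF := approx_filter_proper Xhom Xinf fI.
have PI := inf_const_proper Xhom Xinf.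
have c1 := @e_alpha_cvg _ _ Xhom Xinf f.
have c2 := @e_alpha_cvg _ _ Xhom Xinf (bm_const (bm_inf Xhom Xinf)).
have J1 : J m (alpha_limit f).
  split; first exact: (@cvg_closure _ (e_alpha X)) c1.
  exists t; split => // x /= H; apply: contrapT => /negP xt; apply: H; exact: fnt.
have J2 : J m (alpha_limit (bm_const (bm_inf Xhom Xinf))).
  split; first exact: (@cvg_closure _ (e_alpha X)) c2.
  by exists [::]; split => // x /=; case.
have E : kpi (@k_rees _ X m) (alpha_limit f) =
         kpi (@k_rees _ X m) (alpha_limit (bm_const (bm_inf Xhom Xinf))).
  by apply: kpi_eq; rewrite /k_rees !asboolT.
apply: (@not_cpt_ge_cvg _ (rees X m) C _ _ (kpi (@k_rees _ X m) (alpha_limit f))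
  U1 U2 PF PI _ _ o1 o2 U12).
- exact: (cvg_comp _ _ c1 (@kpi_continuous _ _ (@k_rees _ X m) _)).
- rewrite E; exact: (cvg_comp _ _ c2 (@kpi_continuous _ _ (@k_rees _ X m) _)).
- apply: filterS (approx_near f t) => g gP /U1P; apply=> x xt.
  have := gP x x xt xt; rewrite (ft _ xt) (cmp_eq x Ze) => /cmpZeP [gx].
  by rewrite /= gx.
(* Near the squeeze towards [bm_inf], an automorphism moves the first point of [t] strictly below
   itself. *)
- case: t t0 {tm ft fnt J1 E U1P} U2P => // x t _ U2P.
  apply: filterS (approx_filterP _ x x) => g gP /U2P /(_ x (mem_head _ _)) /= [gx].
  by move: gP; rewrite /mkset gx cmp_inf cmp_eq.
Qed.

Lemma not_rees1_ge_e_alpha : ~ cpt_ge (rees X 1) (e_alpha X).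
Proof.
have [x _] := chain_fresh Xinf [::].
apply: (@not_rees_ge [:: x] 1 (e_alpha X) (~` fixes [:: x]) (fixes [:: x])) => //.
- exact: fixes_closed.
- exact: fixes_open.
- by move=> f; have [H|H] := pselect (fixes [:: x] f); [right|left].
Qed.

Lemma uniq_seq_ex n : exists t : seq X, uniq t /\ size t = n.
Proof.
elim: n => [|n [t [ut st]]]; first by exists [::].
by have [x xt] := chain_fresh Xinf t; exists (x :: t); rewrite /= xt ut st.
Qed.

(** Take [t] with n+1 distinct points. No element of [J n] fixes [t], so [fixes t] and its
    complement descend to [rees X n], while [rees X n.+1] collapses a limit that fixes [t]. *)
Lemma not_rees_ge_rees n : ~ cpt_ge (rees X n.+1) (rees X n).
Proof.
have [t [ut st]] := uniq_seq_ex n.+1.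
have JF f : J n f -> ~ fixes t f.
  move=> [_ [s [fs sn]]] ft.
  have /(uniq_leq_size ut) : {subset t <= s} by move=> x xt; apply: fs; rewrite /Dom /= ft.
  by rewrite st => /leq_trans /(_ sn); rewrite ltnn.
have sat (V : set {ptws aX X -> aX X}) : (forall f f', J n f -> J n f' -> V f -> V f') ->
    forall f f', k_rees n f = k_rees n f' -> V f -> V f'.
  move=> VJ f f'; rewrite /k_rees; case: asboolP => H; case: asboolP => // H'.
    by move=> _; exact: VJ.
  by case=> ->.
have s1 : forall f f', k_rees n f = k_rees n f' -> (~` fixes t) f -> (~` fixes t) f'.
  by apply: sat => f f' _ /JF.
have s2 : forall f f', k_rees n f = k_rees n f' -> fixes t f -> fixes t f'.
  by apply: sat => f f' /JF.
apply: (@not_rees_ge t n.+1 (rees X n) [set q | (~` fixes t) (krepr q)]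
  [set q | fixes t (krepr q)]).
- by rewrite -size_eq0 st.
- by rewrite st.
- by apply: kquot_open s1; exact: fixes_closed.
- by apply: kquot_open s2; exact: fixes_open.
- by move=> q; have [H|H] := pselect (fixes t (krepr q)); [right|left].
- by move=> g; apply: s1; exact: krepr_kpi.
- by move=> g; apply: s2; exact: krepr_kpi.
Qed.

End Rees.

(** * Assembly of the diagram *)

Theorem mainTheorem19 (disp : Order.disp_t) (X : orderType disp) :
  ~ finite_set [set: X] ->
  ultrahomogeneous X ->
  (* e_{b_m X} G > e_{b^<-> X} G > e_{b^+ X} G > e_{alpha X} G > e/rho_{J^1} > ... *)
  (cpt_gt (e_bm X) (e_lr X) /\ cpt_gt (e_lr X) (e_plus X) /\
   cpt_gt (e_plus X) (e_alpha X) /\ cpt_gt (e_alpha X) (rees X 1) /\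
   (forall n : nat, cpt_gt (rees X n.+1) (rees X n.+2))) /\
  (* e_{b_m X} G > e_{b^updown X} G > e_{b^+ X} G *)
  (cpt_gt (e_bm X) (e_ud X) /\ cpt_gt (e_ud X) (e_plus X)) /\
  (continuously_ordered X -> cpt_equiv (b_r X) (e_bm X)) /\
  (~ continuously_ordered X ->
     cpt_gt (e_bm X) (b_r X) /\ cpt_gt (b_r X) (e_alpha X) /\
     cpt_incomparable (b_r X) (e_lr X) /\
     cpt_incomparable (b_r X) (e_ud X) /\
     cpt_incomparable (b_r X) (e_plus X)).
Proof.
move=> Xinf Xhom.
have bm_lr : cpt_ge (e_bm X) (e_lr X) := e_bm_ge_kquot (@k_lr _ X).
have bm_ud : cpt_ge (e_bm X) (e_ud X) := e_bm_ge_kquot (@k_ud _ X).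
have lr_plus := @e_lr_ge_e_plus _ X.
have ud_plus := @e_ud_ge_e_plus _ X.
have plus_alpha := @e_plus_ge_e_alpha _ X.
have bm_X := @e_bm_ge_e_X _ X.
(* Since [b_r] and [e_X] dominate each other, comparisons with [b_r] are settled on [e_X]. *)
have r_X := b_r_ge_e_X Xhom Xinf.
have X_r := e_X_ge_b_r Xhom.
have bm_r := cpt_ge_trans bm_X X_r.
have lr_X := not_e_lr_ge_e_X Xhom Xinf.
have ud_X := not_e_ud_ge_e_X Xhom Xinf.
have lr_r : ~ cpt_ge (e_lr X) (b_r X) by move=> /cpt_ge_trans /(_ r_X).
have ud_r : ~ cpt_ge (e_ud X) (b_r X) by move=> /cpt_ge_trans /(_ r_X).
have plus_r : ~ cpt_ge (e_plus X) (b_r X) by move=> /(cpt_ge_trans lr_plus).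
split; [|split; [|split]].
- repeat split=> //.
  + by move=> /cpt_ge_trans /(_ bm_X).
  + exact: not_e_plus_ge_e_lr.
  + exact: not_e_alpha_ge_e_plus.
  + exact: e_alpha_ge_rees.
  + exact: not_rees1_ge_e_alpha.
  + exact: rees_ge_rees.
  + exact: not_rees_ge_rees.
- repeat split=> //.
  + by move=> /cpt_ge_trans /(_ bm_X).
  + exact: not_e_plus_ge_e_ud.
- by move=> co; split=> //; apply: cpt_ge_trans r_X _; exact: e_X_ge_e_bm.
- move=> nco; have nX := not_e_X_ge_e_plus Xhom Xinf nco.
  (* As [e_plus] lies below [e_lr] and [e_ud], this one failure gives the corresponding failures for
     both. *)
  have r_plus : ~ cpt_ge (b_r X) (e_plus X) by move=> /(cpt_ge_trans X_r).
  repeat split=> //.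
  + by move=> /cpt_ge_trans /(_ (cpt_ge_trans bm_lr lr_plus)).
  + exact: cpt_ge_trans r_X (@e_X_ge_e_alpha _ X).
  + by move=> /(cpt_ge_trans plus_alpha).
  + by move=> /cpt_ge_trans /(_ lr_plus).
  + by move=> /cpt_ge_trans /(_ ud_plus).
Qed.
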